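(* Let $\Lambda=\Lambda(\underline p,\underline\lambda)$ be a canonical algebra with $t$ arms over an algebraically closed field $k$. Then each exceptional $\Lambda$-module $M$ of rank two can be described by matrices having entries $0$, $\lambda_i$ and $-\lambda_i$; that is, one can choose bases of the vector spaces $M_v$ ($v$ a vertex of the quiver of $\Lambda$) such that for every arrow $\alpha$ the matrix of $M_\alpha$ has all entries in $\{0\}\cup\{\lambda_i,-\lambda_i\mid 3\le i\le t\}$.
   Context: Canonical algebras: let $t\ge 3$, let $\underline p=(p_1,\dots,p_t)$ be integers $p_i\ge 2$ (weights) and $\underline\lambda=(\lambda_3,\dots,\lambda_t)$ pairwise distinct nonzero elements of $k$ (parameters), normalized so that $\lambda_3=1$. The canonical algebra $\Lambda(\underline p,\underline\lambda)$ with $t$ arms is the path algebra of the quiver with vertices $0$, $m\vec x_i$ ($1\le i\le t$, $1\le m\le p_i-1$) and $\vec c$, and arrows $\alpha^{(i)}_m:(m-1)\vec x_i\to m\vec x_i$ for $1\le i\le t$, $1\le m\le p_i$ (with $0\vec x_i=0$ and $p_i\vec x_i=\vec c$), modulo the canonical relations $\alpha^{(i)}_{p_i}\cdots\alpha^{(i)}_1=\alpha^{(1)}_{p_1}\cdots\alpha^{(1)}_1+\lambda_i\,\alpha^{(2)}_{p_2}\cdots\alpha^{(2)}_1$ for $i=3,\dots,t$. Modules are finitely generated right modules: such a module $M$ consists of finite-dimensional vector spaces $M_v$ for every vertex $v$ and linear maps $M_\alpha:M_w\to M_v$ for every arrow $\alpha:v\to w$, satisfying the canonical relations. The rank of $M$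 is $\mathrm{rk}\,M=\dim_k M_0-\dim_k M_{\vec c}$. $M$ is exceptional if $\mathrm{End}_\Lambda(M)=k$ and $\mathrm{Ext}^i_\Lambda(M,M)=0$ for all $i\ge1$. *)

(* Defs.v *)
From mathcomp Require Import all_boot all_order all_algebra.

Set Implicit Arguments.
Unset Strict Implicit.
Unset Printing Implicit Defensive.

Import GRing.Theory.
Local Open Scope ring_scope.

(* The arms 1, ..., t are indexed by 0, ..., t - 1.  Only param i with 2 <= i
   (that is, lambda_3, ..., lambda_t) is meaningful; the values of param at 0
   and 1 are never used. *)
Record canonical_datum (k : fieldType) := CanonicalDatum {
  arms : nat;
  arms_ge3 : (3 <= arms)%N;
  weight : 'I_arms -> nat;
  weight_ge2 : forall i, (2 <= weight i)%N;
  param : 'I_arms -> k;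
  param_neq0 : forall i : 'I_arms, (2 <= i)%N -> param i != 0;
  param_inj : forall i j : 'I_arms, (2 <= i)%N -> (2 <= j)%N ->
    param i = param j -> i = j;
  param_norm : forall i : 'I_arms, i = 2%N :> nat -> param i = 1
}.

Section CanonicalModules.

Variables (k : fieldType) (L : canonical_datum k).

Definition arm1 : 'I_(arms L) := Ordinal (ltnW (ltnW (arms_ge3 L))).
Definition arm2 : 'I_(arms L) := Ordinal (ltnW (arms_ge3 L)).

(* Inner i m is the vertex (m + 1) x_i. *)
Inductive vertex : Type :=
| Zero
| Inner (i : 'I_(arms L)) (m : 'I_(weight i).-1)
| Top.

(* The vertex m x_i, for m <= weight i, with 0 x_i = 0 and p_i x_i = c. *)
Definition arm_vertex (i : 'I_(arms L)) (m : nat) : vertex :=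
  if m is m'.+1 then
    if (insub m' : option 'I_(weight i).-1) is Some u then @Inner i u else Top
  else Zero.

Lemma arm_vertex_weight i : arm_vertex i (weight i) = Top.
Proof.
have [n wi] : exists n, weight i = n.+1.
  by exists (weight i).-1; rewrite prednK // ltnW // weight_ge2.
by rewrite {1}wi /= insubF // wi ltnn.
Qed.

Section ArmMap.

Variables (M : vertex -> vectType k)
  (a : forall i (m : 'I_(weight i)),
     'Hom(M (arm_vertex i m.+1), M (arm_vertex i m))).

Fixpoint arm_map_upto i (m : nat) :
    (m <= weight i)%N -> 'Hom(M (arm_vertex i m), M Zero) :=
  match m with
  | 0 => fun _ => \1%VF
  | m'.+1 => fun lt_m' =>
      (arm_map_upto (ltnW lt_m') \o a (Ordinal lt_m'))%VF
  end.

(* The action of the path alpha_p ... alpha_1 of the arm i; modules being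
   right modules, it is M_{alpha_1} \o ... \o M_{alpha_p} : M_c -> M_0. *)
Definition arm_map i : 'Hom(M Top, M Zero) :=
  eq_rect _ (fun v => 'Hom(M v, M Zero)) (arm_map_upto (leqnn (weight i)))
    _ (arm_vertex_weight i).

End ArmMap.

(* act i m is the action of the arrow m x_i -> (m + 1) x_i. *)
Record cmodule := CModule {
  space :> vertex -> vectType k;
  act : forall i (m : 'I_(weight i)),
    'Hom(space (arm_vertex i m.+1), space (arm_vertex i m));
  canonical_rel : forall i : 'I_(arms L), (2 <= i)%N ->
    arm_map act i = arm_map act arm1 + param i *: arm_map act arm2
}.

Record cmod_hom (M N : cmodule) := CModHom {
  hom_at :> forall v, 'Hom(M v, N v);
  hom_natural : forall i (m : 'I_(weight i)),
    (hom_at (arm_vertex i m) \o act M m =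
     act N m \o hom_at (arm_vertex i m.+1))%VF
}.

Definition cmod_epi (M N : cmodule) (f : cmod_hom M N) : Prop :=
  forall v, limg (f v) = fullv.

Definition projective (P : cmodule) : Prop :=
  forall (M N : cmodule) (q : cmod_hom M N) (f : cmod_hom P N),
    cmod_epi q -> exists g : cmod_hom P M, forall v, f v = (q v \o g v)%VF.

Record proj_resolution (M : cmodule) := ProjResolution {
  res_term : nat -> cmodule;
  res_diff : forall n, cmod_hom (res_term n.+1) (res_term n);
  res_aug : cmod_hom (res_term 0) M;
  res_proj : forall n, projective (res_term n);
  res_aug_epi : cmod_epi res_aug;
  res_exact0 : forall v, lker (res_aug v) = limg (res_diff 0 v);
  res_exactS : forall n v, lker (res_diff n v) = limg (res_diff n.+1 v)
}.

(* Ext^(n+1)(M, N) = 0: the complex Hom(P, N) is exact in degree n + 1, for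
   every projective resolution P of M. *)
Definition ext_vanishS (n : nat) (M N : cmodule) : Prop :=
  forall (P : proj_resolution M) (f : cmod_hom (res_term P n.+1) N),
    (forall v, (f v \o res_diff P n.+1 v)%VF = 0) ->
    exists g : cmod_hom (res_term P n) N,
      forall v, f v = (g v \o res_diff P n v)%VF.

(* Uniqueness of the scalar expresses that k -> End(M) is injective, i.e. that
   M is nonzero. *)
Definition end_trivial (M : cmodule) : Prop :=
  forall f : cmod_hom M M, exists! c : k, forall v, f v = c *: \1%VF.

Definition exceptional (M : cmodule) : Prop :=
  end_trivial M /\ forall n, ext_vanishS n M M.

Definition rank (M : cmodule) : int :=
  (\dim {: M Zero})%:Z - (\dim {: M Top})%:Z.

End CanonicalModules.

(* Main.v *)
(* Write phi_i : M_c -> M_0 for the action of the arm i, and n = dim M_c, so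
   that dim M_0 = n + 2.

   All the maps of M are injective.  If phi_i(u) = 0 but phi_j(u) <> 0, then,
   for a functional psi killing the image of phi_i, the rank one maps
   phi_j(u) (x) psi on M_0 and u (x) (psi o phi_j) on M_c extend to an
   endomorphism of M, which is not a scalar since dim M_0 >= 2.  Hence all
   the phi_i have the same kernel, and then the elements mapped to zero in M_0
   are a direct summand, which is zero as M is indecomposable.

   So M is the pencil (phi_1, phi_2) together with, on each arm, a filtration
   from M_0 down to the image of phi_i, where the codimension is two; an arm
   contributes at most one hyperplane ker psi_i.  As Ext^1(M, M) = 0, every
   infinitesimal deformation of M is trivial.  Deforming phi_1 and phi_2 shows
   that the pencil is rigid, and deforming a single hyperplane shows that, for
   each i, some endomorphism of the pencil moves ker psi_i and preserves the
   other ker psi_j.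

   A rigid pencil with n >= 2 satisfies phi_1 U + phi_2 U = V, hence is
   determined by the pencil {(a, b) | phi_2 a = phi_1 b} -> U of dimensions
   (n - 2, n), which inherits the hypotheses.  Starting from the cases n = 0
   and n = 1, this yields bases with phi_1 u_j = v_j and phi_2 u_j = v_(j+2)
   such that each hyperplane is spanned by the image of phi_i and one vector
   with coordinates 0 and 1. *)

From HB Require Import structures.
Require Import Defs.
From mathcomp Require Import all_boot all_order all_algebra.
From mathcomp Require Import ring zify.

Set Implicit Arguments.
Unset Strict Implicit.
Unset Printing Implicit Defensive.

Import GRing.Theory.
Local Open Scope ring_scope.

(** * Linear algebra *)

Section LinearAlgebra.
Variable k : fieldType.
Implicit Types A B C : vectType k.

(** Turns a formula and its linearity into a linear map; most maps below are introduced this way. *)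
Lemma lfun_ex A B (f : A -> B) : linear f -> {g : 'Hom(A, B) | g =1 f}.
Proof.
move=> lin; pose F := GRing.isLinear.Build k A B _ f lin.
pose G : {linear A -> B} := HB.pack f F.
by exists (linfun G) => x; rewrite (lfunE G).
Qed.

Lemma lfunZ A B (f : 'Hom(A, B)) (c : k) x : f (c *: x) = c *: f x.
Proof. exact: linearZ. Qed.

Lemma lfunBZ A B (f : 'Hom(A, B)) (c : k) x y :
  f (x - c *: y) = f x - c *: f y.
Proof. by rewrite linearB /= lfunZ. Qed.

Lemma lfunD A B (f : 'Hom(A, B)) x y : f (x + y) = f x + f y.
Proof. exact: linearD. Qed.

Lemma lfunB A B (f : 'Hom(A, B)) x y : f (x - y) = f x - f y.
Proof. exact: linearB. Qed.

Lemma lfunDZ A B (f : 'Hom(A, B)) (c : k) x y :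
  f (x + c *: y) = f x + c *: f y.
Proof. by rewrite linearD /= lfunZ. Qed.

Lemma functionalZ A (f : 'Hom(A, k^o)) (c : k) x : f (c *: x) = c * f x.
Proof. exact: linearZ. Qed.

Lemma functionalP A (f : 'Hom(A, k^o)) (a b : k) x y :
  f (a *: x + b *: y) = a * f x + b * f y.
Proof. by rewrite linearD /= !functionalZ. Qed.

Fact outer_key A B (b : B) (psi : 'Hom(A, k^o)) :
  {g : 'Hom(A, B) | forall x, g x = (psi x : k) *: b}.
Proof.
apply: lfun_ex => c x y; rewrite linearP /= scalerDl scalerA.
by [].
Qed.

Definition outer A B (b : B) (psi : 'Hom(A, k^o)) := sval (outer_key b psi).

Lemma outerE A B (b : B) (psi : 'Hom(A, k^o)) x :
  outer b psi x = (psi x : k) *: b.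
Proof. exact: (svalP (outer_key b psi)). Qed.

(** The component of x outside W is nonzero, so it has a nonzero coordinate; psi is that coordinate
    of z - projv W z, normalized at x. *)
Lemma separate A (W : {vspace A}) x : x \notin W ->
  exists2 psi : 'Hom(A, k^o), psi x = 1 & forall w, w \in W -> psi w = 0.
Proof.
move=> xW; pose y := x - projv W x.
have y0 : y != 0.
  by apply: contra xW; rewrite subr_eq0 => /eqP->; exact: memv_proj.
have [i ci] : exists i, coord (vbasis {:A}) i y != 0.
  apply/existsP; rewrite -negb_forall; apply: contra y0 => /forallP h.
  rewrite (coord_vbasis (memvf y)) big1 // => i _.
  by rewrite (eqP (h i)) scale0r.
have [f fE] : {f : 'Hom(A, k^o) | forall z,
    f z = (coord (vbasis {:A}) i y)^-1 * coord (vbasis {:A}) i (z - projv W z)}.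
  apply: lfun_ex => c z t.
  have -> : c *: z + t - projv W (c *: z + t) =
            c *: (z - projv W z) + (t - projv W t).
    by rewrite linearP scalerBr opprD addrACA.
  by rewrite linearP mulrDr; congr (_ + _); rewrite mulrCA.
exists f; first by rewrite fE -/y mulVf.
by move=> w wW; rewrite fE projv_id // subrr linear0 mulr0.
Qed.

Lemma separate_neq0 A x : x != 0 -> exists psi : 'Hom(A, k^o), psi x = 1.
Proof.
rewrite -memv0 => /separate[psi p _]; by exists psi.
Qed.

(** The pseudo-inverse of f sends f x back to x up to an element of the kernel of f, which xi
    kills. *)
Lemma factor_ker A B C (f : 'Hom(A, B)) (xi : 'Hom(A, C)) :
  (forall x, f x = 0 -> xi x = 0) -> forall x, (xi \o f^-1)%VF (f x) = xi x.
Proof.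
move=> h x; rewrite comp_lfunE; apply/eqP; rewrite -subr_eq0 -linearB.
by apply/eqP/h; rewrite linearB /= limg_lfunVK ?subrr // memv_img // memvf.
Qed.

Lemma lker0_trivial A B (f : 'Hom(A, B)) :
  (forall x, f x = 0 -> x = 0) -> lker f == 0%VS.
Proof.
move=> h; rewrite -subv0; apply/subvP => x; rewrite memv_ker memv0.
by move/eqP/h->.
Qed.

End LinearAlgebra.

(** * Rigid pencils *)

Section Pencil.
(** The hypotheses make the (al i : be i) pairwise distinct points of the projective line; for a
    canonical algebra they are (1 : 0), (0 : 1) and (1 : lambda_i). *)
Variables (k : fieldType) (I : finType) (al be : I -> k).
Hypothesis ab_neq0 : forall i, be i = 0 -> al i != 0.
Hypothesis ab_det : forall i j, i != j -> al i * be j != al j * be i.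

Section OnePencil.
Variables (U V : vectType k) (p1 p2 : 'Hom(U, V)).

(* Vanishing of the self-extensions of the Kronecker module (p1, p2). *)
Definition rigid_pencil := forall D1 D2 : 'Hom(U, V),
  exists (gU : 'End(U)) (gV : 'End(V)),
    (forall x, D1 x = p1 (gU x) - gV (p1 x)) /\
    (forall x, D2 x = p2 (gU x) - gV (p2 x)).

Definition pencil_endo (gU : 'End(U)) (gV : 'End(V)) :=
  (forall x, p1 (gU x) = gV (p1 x)) /\ (forall x, p2 (gU x) = gV (p2 x)).

Definition pencil_at i x := al i *: p1 x + be i *: p2 x.

(** For nonzero psi: g preserves the hyperplane ker psi and acts on V / ker psi by c. *)
Definition eigen (g : 'End(V)) (psi : 'Hom(V, k^o)) :=
  exists c : k, forall x, psi (g x) = c * psi x.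

Variables (S : {set I}) (psi : I -> 'Hom(V, k^o)).

Definition separated := forall i, i \in S -> exists gU gV,
  [/\ pencil_endo gU gV,
      forall j, j \in S -> j != i -> eigen gV (psi j)
    & ~ eigen gV (psi i)].

(* With us and vs, the pencil is the direct sum of the two chains of even and
   of odd indices. *)
Definition normal_form n := exists (us : nat -> U) (vs : nat -> V),
  [/\ forall j, (j < n)%N -> p1 (us j) = vs j,
      forall j, (j < n)%N -> p2 (us j) = vs j.+2,
      (<<mkseq us n>> = fullv)%VS,
      (<<mkseq vs n.+2>> = fullv)%VS &
      forall i, i \in S -> exists c d : bool,
        let o := if be i == 0 then n else 0%N in
        let w := c%:R *: vs o + d%:R *: vs o.+1 in
        psi i w = 0 /\ forall x, w != pencil_at i x].

(** Suppose that eta <> 0 kills both images and p1 a + p2 b = 0. Applying eta to the rigidity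
    equations at a and b gives eta (D1 a) + eta (D2 b) = 0 for all D1, D2, and rank one choices of
    D1, D2 force a = b = 0. So the map (a, b) |-> p1 a + p2 b is onto, or injective and not onto. *)
Lemma rigid_pencil_dim : rigid_pencil ->
  (limg p1 + limg p2 = fullv)%VS \/ 
  ((forall a b, p1 a + p2 b = 0 -> a = 0 /\ b = 0) /\
   (2 * \dim {:U} < \dim {:V})%N).
Proof.
move=> rig; case: (eqVneq (limg p1 + limg p2)%VS fullv) => [->|nfull]; first by left.
have [v _ vN] : exists2 v, v \in fullv & v \notin (limg p1 + limg p2)%VS.
  by apply/subvPn; apply: contra nfull => h; rewrite eqEsubv subvf.
right; have [eta eta1 eta0] := separate vN.
have eta_p1 x : eta (p1 x) = 0.
  by apply: eta0; rewrite (subvP (addvSl _ _)) // memv_img // memvf.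
have eta_p2 x : eta (p2 x) = 0.
  by apply: eta0; rewrite (subvP (addvSr _ _)) // memv_img // memvf.
have inj a b : p1 a + p2 b = 0 -> a = 0 /\ b = 0.
  move=> ab0.
  have key (D1 D2 : 'Hom(U, V)) : eta (D1 a) + eta (D2 b) = 0.
    have [gU [gV [-> ->]]] := rig D1 D2.
    rewrite !linearB /= eta_p1 eta_p2 !sub0r -opprD -linearD /= -linearD /=.
    by rewrite ab0 !linear0.
  split; apply/eqP; apply: contraT => /separate_neq0[xi xi1].
    have := key (outer v xi) 0.
    rewrite outerE zero_lfunE linear0 addr0 xi1 scale1r eta1 => /eqP.
    by rewrite oner_eq0.
  have := key 0 (outer v xi).
  rewrite outerE zero_lfunE linear0 add0r xi1 scale1r eta1 => /eqP.
  by rewrite oner_eq0.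
split=> //.
have cap0 : (limg p1 :&: limg p2 = 0)%VS.
  apply/eqP; rewrite -subv0; apply/subvP => x; rewrite memv_cap memv0.
  case/andP=> /memv_imgP[a _ ->] /memv_imgP[b _ e].
  have [|-> _] := inj a (- b); first by rewrite e linearN /= subrr.
  by rewrite linear0.
have d1 : \dim (limg p1) = \dim {:U}.
  apply: limg_dim_eq; rewrite capfv; apply/eqP/lker0_trivial => x e.
  by case: (inj x 0); rewrite ?e ?linear0 ?addr0.
have d2 : \dim (limg p2) = \dim {:U}.
  apply: limg_dim_eq; rewrite capfv; apply/eqP/lker0_trivial => x e.
  by case: (inj 0 x); rewrite ?e ?linear0 ?addr0.
rewrite mul2n -addnn -{1}d1 -{1}d2 -(dimv_disjoint_sum cap0).
rewrite ltnNge; apply: contra nfull => h.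
by rewrite eqEdim subvf.
Qed.

Lemma proportional (f g : 'Hom(V, k^o)) : f != 0 ->
  (forall x, f x = 0 -> g x = 0) -> exists c : k, forall x, g x = c * f x.
Proof.
case/lfunPn=> x; rewrite zero_lfunE => fx sub; exists (g x / f x) => y.
have lin (h : 'Hom(V, k^o)) (c : k) : h (y - c *: x) = h y - c * h x.
  by rewrite linearB linearZ.
have := sub (y - (f y / f x : k) *: x).
rewrite !lin divfK // subrr => /(_ erefl)/eqP; rewrite subr_eq0 => /eqP->.
by rewrite mulrC mulrCA mulrC.
Qed.

Hypothesis psi_neq0 : forall i, i \in S -> psi i != 0.
Hypothesis sep : separated.

(** If ker psi_i lay in ker psi_j, then psi_j would be a multiple of psi_i, and an endomorphism
    preserving ker psi_i could not move ker psi_j. *)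
Lemma separated_indep i j : i \in S -> j \in S -> i != j ->
  exists2 v, psi i v = 0 & psi j v != 0.
Proof.
move=> iS jS ij.
have [|] := boolP (lker (psi i) <= lker (psi j))%VS.
  move/subvP => sub; have [|c e] := proportional (g := psi j) (psi_neq0 iS).
    by move=> x x0; apply/eqP; rewrite -memv_ker; apply: sub; rewrite memv_ker x0.
  have [gU [gV [_ eig neig]]] := sep jS.
  case: neig; have [d ed] := eig i iS ij.
  by exists d => x; rewrite !e ed mulrCA.
by case/subvPn=> v; rewrite !memv_ker => /eqP v0 v1; exists v.
Qed.

(** The hyperplanes are lines in a plane, and separation allows at most three different ones: two
    serve as coordinate axes, and a rescaling makes the third the diagonal. *)
Lemma normal_form0 : \dim {:U} = 0 -> \dim {:V} = 2 -> normal_form 0.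
Proof.
move=> dU dV.
have U0 (x : U) : x = 0.
  apply/eqP; rewrite -memv0; suff <- : fullv = 0%VS :> {vspace U}.
    exact: memvf.
  by apply/eqP; rewrite -dimv_eq0 dU.
have [v0 [v1 [sp one]]] : exists v0 v1, (<<[:: v0; v1]>> = fullv)%VS /\
   forall i j, i \in S -> j \in S -> i != j ->
    psi i v0 != 0 -> psi i v1 != 0 -> psi j v0 != 0 -> psi j v1 != 0 -> False.
  have [le1|] := leqP #|S| 1.
    have [v0 [v1 e]] : exists v0 v1, vbasis {:V} = [:: v0; v1] :> seq V.
      case: (vbasis {:V}) => s /= /eqP; rewrite dV.
      by case: s => [|x [|y [|z s]]] // _; exists x, y.
    exists v0, v1; rewrite -e (span_basis (vbasisP _)); split=> // i j iS jS.
    by move/card_le1P: le1 => /(_ i iS j); rewrite jS inE eq_sym => <-.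
  case/card_gt1P=> i [j [iS jS ij]].
  have [v0 i0 j0] := separated_indep iS jS ij.
  have [v1 j1 i1] := separated_indep jS iS (etrans (congr1 negb (eq_sym j i)) ij).
  exists v0, v1.
  have fr : free [:: v0; v1].
    rewrite free_cons span_seq1 seq1_free; apply/andP; split.
      apply: contraNN j0 => /vlineP[c ->].
      by rewrite linearZ /= j1 scaler0.
    by apply: contraNneq i1 => ->; rewrite linear0.
  have sp : (<<[:: v0; v1]>> = fullv)%VS.
    by apply/eqP; rewrite eqEdim subvf (eqP fr) dV.
  have spP x : exists a b : k, x = a *: v0 + b *: v1.
    have : x \in <<[:: v0; v1]>>%VS by rewrite sp memvf.
    rewrite span_cons span_seq1 => /memv_addP[_ /vlineP[a ->]].
    by case=> _ /vlineP[b ->] ->; exists a, b.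
  split=> // l q lS qS lq l0 l1 q0 q1.
  (* The endomorphism separating q preserves the kernels of psi_i and psi_j, so it is diagonal in
     v0, v1; preserving ker psi_l as well, it is a scalar and cannot move ker psi_q. *)
  have [gU [gV [_ eig neig]]] := sep qS.
  have iq : i != q by apply: contraNneq q0 => <-; rewrite i0.
  have jq : j != q by apply: contraNneq q1 => <-; rewrite j1.
  have [ci ei] := eig _ iS iq; have [cj ej] := eig _ jS jq.
  have [cl el] := eig _ lS lq; case: neig; exists cl => x.
  have [a [b g0]] := spP (gV v0); have [c [d g1]] := spP (gV v1).
  have lin (h : 'Hom(V, k^o)) (c1 c2 : k) u1 u2 :
      h (c1 *: u1 + c2 *: u2) = c1 * h u1 + c2 * h u2.
    by rewrite linearD !linearZ.
  have b0 : b = 0.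
    apply/eqP; have := ei v0; rewrite g0 lin i0 !mulr0 add0r => /eqP.
    by rewrite mulf_eq0 (negPf i1) orbF.
  have c0 : c = 0.
    apply/eqP; have := ej v1; rewrite g1 lin j1 !mulr0 addr0 => /eqP.
    by rewrite mulf_eq0 (negPf j0) orbF.
  have acl : a = cl.
    by apply: (mulIf l0); rewrite -el g0 b0 lin mul0r addr0.
  have dcl : d = cl.
    by apply: (mulIf l1); rewrite -el g1 c0 lin mul0r add0r.
  have [x0 [x1 ->]] := spP x.
  rewrite linearD !linearZ /= g0 g1 b0 c0 acl dcl !scale0r add0r addr0 !lin.
  by rewrite !functionalZ; ring.
have {one} [c c0 one] : exists2 c : k, c != 0 & forall i, i \in S ->
    [\/ psi i v0 = 0, psi i (c *: v1) = 0 | psi i (v0 + c *: v1) = 0].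
  have [/existsP[l /and3P[lS l0 l1]]|] :=
      boolP [exists l, [&& l \in S, psi l v0 != 0 & psi l v1 != 0]].
    (* This scalar puts v0 + c v1 into the kernel of the only functional that is nonzero on both v0
       and v1. *)
    exists (- psi l v0 / psi l v1).
      by rewrite mulf_neq0 ?oppr_eq0 ?invr_neq0.
    move=> i iS; have [->|il] := eqVneq i l.
      by constructor 3; rewrite linearD /= functionalZ divfK // subrr.
    have [|i0] := eqVneq (psi i v0) 0; first by constructor 1.
    have [i1|i1] := eqVneq (psi i v1) 0.
      by constructor 2; rewrite functionalZ i1 mulr0.
    by case: (one l i) => //; rewrite eq_sym.
  rewrite negb_exists => /forallP h; exists 1; first exact: oner_neq0.
  move=> i iS; have := h i; rewrite iS /= negb_and !negbK.
  by case/orP=> /eqP e; [constructor 1 | constructor 2; rewrite scale1r].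
have fr : free [:: v0; v1] by rewrite /free sp dV.
exists (fun=> 0), (fun j => if j is 0%N then v0 else c *: v1); split=> //.
- by rewrite span_nil; apply/eqP; rewrite eq_sym -dimv_eq0 dU.
- apply/eqP; rewrite eqEsubv subvf -sp; apply/span_subvP => x.
  rewrite !inE => /orP[] /eqP->; first by apply: memv_span; rewrite inE eqxx.
  suff /(memvZ c^-1) : c *: v1 \in <<[:: v0; c *: v1]>>%VS by rewrite scalerK.
  by apply: memv_span; rewrite !inE eqxx orbT.
move=> i iS.
have wN (w : V) : w != 0 -> forall x, w != pencil_at i x.
  by move=> w0 x; rewrite /pencil_at (U0 x) !linear0 addr0.
have v1N : c *: v1 != 0.
  rewrite scaler_eq0 (negPf c0) /=.
  by apply: (free_not0 fr); rewrite !inE eqxx orbT.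
have v0N : v0 != 0 by apply: (free_not0 fr); rewrite !inE eqxx.
have v01N : v0 + c *: v1 != 0.
  apply: contraTneq fr => /eqP; rewrite addr_eq0 => /eqP->.
  rewrite free_cons span_seq1 -scaleNr.
  by rewrite memvZ // memv_line.
rewrite if_same /=; case: (one i iS) => e.
- by exists true, false; rewrite scale1r scale0r addr0; split; last exact: wN.
- by exists false, true; rewrite scale1r scale0r add0r; split; last exact: wN.
by exists true, true; rewrite !scale1r; split; last exact: wN.
Qed.

Hypothesis psi_pencil : forall i x, i \in S -> psi i (pencil_at i x) = 0.

(** Endomorphisms of the pencil act by a scalar on the plane H = <h1, h2>. If psi_i vanished on H,
    it would be an eigenvector for all of them; so ker psi_i meets H in the line of e_i, and only a
    vector outside H remains to be chosen. *)
Lemma normal_form1 : rigid_pencil -> \dim {:U} = 1 -> \dim {:V} = 3 ->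
  normal_form 1.
Proof.
move=> rig dU dV.
have [u spU] : exists u, (<[u]> = fullv :> {vspace U})%VS.
  case: (vbasis {:U}) (vbasisP {:U}) => s /= /eqP; rewrite dU.
  by case: s => [|u [|y s]] // _ /span_basis; rewrite span_seq1; exists u.
have uP x : exists c : k, x = c *: u by apply/vlineP; rewrite spU memvf.
have u0 : u != 0 by have := dim_vline u; rewrite spU dU; case: (u != 0).
(* Two images of dimension at most one do not span V, which has dimension three. *)
have inj a b : p1 a + p2 b = 0 -> a = 0 /\ b = 0.
  case: (rigid_pencil_dim rig) => [full|[inj _]]; last exact: inj.
  have := (dimv_add_leqif (limg p1) (limg p2)).1; rewrite full dV.
  have := limg_ker_dim p1 fullv; have := limg_ker_dim p2 fullv.
  rewrite dU => e1 e2.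
  have := leq_add (leq_addl (\dim (fullv :&: lker p1)) (\dim (limg p1)))
                  (leq_addl (\dim (fullv :&: lker p2)) (\dim (limg p2))).
  by rewrite e1 e2 => h1 h2; have := leq_trans h2 h1.
pose h1 := p1 u; pose h2 := p2 u; pose e i := pencil_at i u.
pose H := <<[:: h1; h2]>>%VS.
have HP x : reflect (exists a b : k, x = a *: h1 + b *: h2) (x \in H).
  apply: (iffP idP) => [|[a' [b' ->]]]; last first.
    by rewrite memvD // memvZ // memv_span // !inE eqxx ?orbT.
  rewrite /H span_cons span_seq1 => /memv_addP[_ /vlineP[c1 ->]].
  by case=> _ /vlineP[c2 ->] ->; exists c1, c2.
have Hp x i : pencil_at i x \in H.
  have [c ->] := uP x; apply/HP; exists (al i * c), (be i * c).
  by rewrite /pencil_at !lfunZ !scalerA.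
have frH : free [:: h1; h2].
  rewrite free_cons span_seq1 seq1_free; apply/andP; split.
    apply/negP => /vlineP[c e1]; have [|u00 _] := inj u (- c *: u).
      by rewrite linearZ /= -/h1 -/h2 e1 scaleNr subrr.
    by rewrite u00 eqxx in u0.
  apply: contraNneq u0 => e2; have [|_ -> //] := inj 0 u.
  by rewrite linear0 add0r.
have eH i j : i != j -> H = <<[:: e i; e j]>>%VS.
  move=> ij; apply/eqP; rewrite eqEsubv; apply/andP; split; last first.
    by apply/span_subvP => x; rewrite !inE => /orP[] /eqP->; exact: Hp.
  pose D := al i * be j - al j * be i.
  have D0 : D != 0 by rewrite subr_eq0 ab_det.
  have e1 : D *: h1 = be j *: e i - be i *: e j.
    rewrite /e /pencil_at -/h1 -/h2 !scalerDr !scalerA opprD addrACA.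
    rewrite -!scalerBl /D (mulrC (be j) (be i)) subrr scale0r addr0.
    by rewrite (mulrC (be j)) (mulrC (be i)).
  have e2 : D *: h2 = al i *: e j - al j *: e i.
    rewrite /e /pencil_at -/h1 -/h2 !scalerDr !scalerA opprD addrACA.
    by rewrite -!scalerBl /D (mulrC (al j) (al i)) subrr scale0r add0r.
  apply/span_subvP => x; rewrite !inE => /orP[] /eqP->.
    rewrite -(scalerK D0 h1) e1 memvZ // memvB // memvZ // memv_span //.
      by rewrite !inE eqxx.
    by rewrite !inE eqxx orbT.
  rewrite -(scalerK D0 h2) e2 memvZ // memvB // memvZ // memv_span //.
    by rewrite !inE eqxx orbT.
  by rewrite !inE eqxx.
have dH : \dim H = 2 by rewrite (eqP frH).
have spV v : v \notin H -> (<<[:: v; h1; h2]>> = fullv)%VS.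
  move=> vH; apply/eqP; rewrite eqEdim subvf dV.
  by have /eqP -> : free [:: v; h1; h2] by rewrite free_cons vH.
have VP v : v \notin H -> forall x, exists (a : k) h, h \in H /\ x = a *: v + h.
  move=> vH x; have : x \in <<[:: v; h1; h2]>>%VS by rewrite spV ?memvf.
  rewrite span_cons => /memv_addP[_ /vlineP[a ->]] [h hH ->].
  by exists a, h.
have [v' _ v'H] : exists2 v, v \in fullv & v \notin H.
  apply/subvPn; apply: contraTN isT => /dimvS.
  by rewrite dV dH.
have endoH gU gV : pencil_endo gU gV ->
    exists c : k, forall h, h \in H -> gV h = c *: h.
  move=> [g1 g2]; have [c gu] := uP (gU u); exists c => _ /HP[a [b ->]].
  rewrite linearD !linearZ /= -g1 -g2 gu !linearZ /= -/h1 -/h2.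
  by rewrite scalerDr !scalerA ![c * _]mulrC.
have psiH i : i \in S -> exists2 h, h \in H & psi i h != 0.
  move=> iS; case: (boolP (H <= lker (psi i))%VS); last first.
    by case/subvPn=> h hH; rewrite memv_ker; exists h.
  move/subvP => sub; have [gU [gV [gP _ neig]]] := sep iS.
  have [c gH] := endoH _ _ gP; case: neig.
  have Hz h : h \in H -> psi i h = 0.
    by move/sub; rewrite memv_ker => /eqP.
  have v'0 : psi i v' != 0.
    apply: contraNneq (psi_neq0 iS) => v'0; apply/eqP/lfunP => x.
    have [a [h [hH ->]]] := VP _ v'H x.
    by rewrite linearD /= functionalZ v'0 Hz // zero_lfunE mulr0 addr0.
  exists (psi i (gV v') / psi i v') => x.
  have [a [h [hH ->]]] := VP _ v'H x.
  rewrite 2!linearD /= linearZ /= (gH h) // linearD /= !functionalZ (Hz h) //.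
  by rewrite !mulr0 !addr0 mulrCA divfK.
have psie i : i \in S -> psi i (e i) = 0 by move=> iS; exact: psi_pencil.
have psiej i j : i \in S -> i != j -> psi i (e j) != 0.
  move=> iS ij; have [h hH] := psiH i iS; apply: contraNneq => ej.
  have : (H <= lker (psi i))%VS.
    rewrite (eH _ _ ij); apply/span_subvP => x; rewrite !inE memv_ker.
    by case/orP=> /eqP->; rewrite ?ej ?psie.
  by move/subvP/(_ _ hH); rewrite memv_ker.
have [v vH one] : exists2 v, v \notin H & forall i j, i \in S -> j \in S ->
    i != j -> psi i v != 0 -> psi j v != 0 -> False.
  have [le1|] := leqP #|S| 1.
    exists v' => // i j iS jS.
    by move/card_le1P: le1 => /(_ i iS j); rewrite jS inE eq_sym => <-.
  case/card_gt1P=> i [j [iS jS ij]]; have ji : j != i by rewrite eq_sym.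
  (* As psi_i kills e_i but not e_j, and conversely for psi_j, these corrections by elements of H
     put v into both kernels. *)
  pose v := v' - (psi i v' / psi i (e j)) *: e j
               - (psi j v' / psi j (e i)) *: e i.
  have vH : v \notin H.
    apply: contra v'H => vH.
    have -> : v' = v + (psi j v' / psi j (e i)) *: e i
                 + (psi i v' / psi i (e j)) *: e j by rewrite /v !subrK.
    by apply: memvD; [apply: memvD => //|]; apply/memvZ/Hp.
  have iv : psi i v = 0.
    rewrite /v !linearB /= !functionalZ psie // mulr0 subr0 divfK ?psiej //.
    by rewrite subrr.
  have jv : psi j v = 0.
    rewrite /v !linearB /= !functionalZ psie // mulr0 subr0 divfK ?psiej //.
    by rewrite subrr.
  exists v => // l q lS qS lq lv qv.
  (* The endomorphism separating q is c on H and preserves the line of v, the common kernel of psi_i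
     and psi_j. As psi_l is nonzero on v, its eigenvalue forces the factor c on v too, so the
     endomorphism is a scalar: a contradiction. *)
  have [gU [gV [gP eig neig]]] := sep qS.
  have iq : i != q by apply: contraNneq qv => <-; rewrite iv.
  have jq : j != q by apply: contraNneq qv => <-; rewrite jv.
  have li : l != i by apply: contraNneq lv => ->; rewrite iv.
  have [c gH] := endoH _ _ gP.
  have [ci gi] := eig _ iS iq; have [cj gj] := eig _ jS jq.
  have [cl gl] := eig _ lS lq; case: neig; exists c => x.
  have clc : cl = c.
    by apply: (mulIf (psiej _ _ lS li)); rewrite -gl gH ?Hp // functionalZ.
  have [a [h [hH gv]]] := VP _ vH (gV v).
  have h0 : h = 0.
    have : h \in <<[:: e i; e j]>>%VS by rewrite -eH.
    rewrite span_cons span_seq1 => /memv_addP[_ /vlineP[x1 ->]].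
    case=> _ /vlineP[x2 ->] hE; move: (gi v) (gj v).
    have lin (f : 'Hom(V, k^o)) : f (a *: v + (x1 *: e i + x2 *: e j)) =
        a * f v + (x1 * f (e i) + x2 * f (e j)).
      by rewrite linearD /= functionalZ functionalP.
    rewrite gv hE !lin iv jv !psie // !mulr0 !add0r addr0.
    move/eqP; rewrite mulf_eq0 (negPf (psiej _ _ iS ij)) orbF => /eqP->.
    move/eqP; rewrite mulf_eq0 (negPf (psiej _ _ jS ji)) orbF => /eqP->.
    by rewrite !scale0r addr0.
  have ac : a = c.
    apply: (mulIf lv); rewrite -clc -gl gv h0 addr0.
    by rewrite functionalZ.
  have [b [h' [h'H ->]]] := VP _ vH x.
  have -> : gV (b *: v + h') = c *: (b *: v + h').
    rewrite [LHS](linearP gV) /= gv h0 ac addr0 gH //.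
    by rewrite [RHS]scalerDr; congr (_ + _); rewrite [LHS]scalerA [RHS]scalerA mulrC.
  exact: functionalZ.
have [c c0 cP] : exists2 c : k, c != 0 & forall i, i \in S -> psi i v = 0 \/
    (if be i == 0 then psi i (v + c *: h2) = 0 else psi i (c *: h1 + v) = 0).
  have [/existsP[l /andP[lS lv]]|] := boolP [exists l, (l \in S) && (psi l v != 0)].
    (* This choice makes h and e_l span H, so that psi_l h <> 0. *)
    pose h := if be l == 0 then h2 else h1.
    have lh : psi l h != 0.
      have [x /HP[a [b ->]]] := psiH l lS; apply: contraNneq => lh.
      have := psie l lS; rewrite /e /pencil_at -/h1 -/h2 !functionalP.
      move: lh; rewrite /h; case: eqP => [bl ->|/eqP bl ->].
        rewrite bl mul0r addr0 => /eqP; rewrite mulf_eq0 (negPf (ab_neq0 bl)) /=.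
        by move/eqP->; rewrite !mulr0 addr0.
      rewrite mulr0 add0r => /eqP; rewrite mulf_eq0 (negPf bl) /=.
      by move/eqP->; rewrite !mulr0 addr0.
    exists (- (psi l v) / psi l h).
      by rewrite mulf_neq0 ?oppr_eq0 ?invr_neq0.
    move=> i iS; have [iv|iv] := eqVneq (psi i v) 0; first by left.
    right; have -> : i = l by apply/eqP; apply: contraT => il; case: (one i l).
    move: lh; rewrite /h; case: (be l == 0) => lh; rewrite linearD /= functionalZ.
      by rewrite divfK // subrr.
    by rewrite divfK // addNr.
  rewrite negb_exists => /forallP none; exists 1; first exact: oner_neq0.
  by move=> i iS; left; have := none i; rewrite iS negbK => /eqP.
(* The even chain is v_0 = c h1, v_2 = c h2, coming from u_0 = c u; the odd chain is the single
   vector v_1 = v. *)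
exists (fun=> c *: u),
  (fun j => match j with 0%N => c *: h1 | 1%N => v | _ => c *: h2 end).
split.
- by case=> // _; rewrite linearZ.
- by case=> // _; rewrite linearZ.
- rewrite span_seq1; apply/eqP; rewrite eqEsubv subvf -spU -memvE.
  by rewrite -[X in X \in _](scalerK c0) memvZ // memv_line.
- apply/eqP; rewrite eqEsubv subvf -(spV v vH); apply/span_subvP => x.
  have sc y s : c *: y \in s -> y \in <<s>>%VS.
    by move=> /memv_span /(memvZ c^-1); rewrite scalerK.
  rewrite !inE => /or3P[] /eqP->.
  + by rewrite memv_span //= !inE eqxx orbT.
  + by apply: sc; rewrite /= !inE eqxx.
  + by apply: sc; rewrite /= !inE eqxx !orbT.
move=> i iS.
have wN (h : V) : h \in H -> forall x, v + h != pencil_at i x.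
  move=> hH x; apply: contraNneq vH => vh.
  by rewrite -(addrK h v) memvB // vh Hp.
have h1H : c *: h1 \in H by rewrite memvZ // memv_span // inE eqxx.
have h2H : c *: h2 \in H by rewrite memvZ // memv_span // !inE eqxx orbT.
case: (cP i iS) => [iv|b].
  exists (be i == 0), (be i != 0); case: eqP => _ /=.
    rewrite scale1r scale0r addr0; split=> // x.
    by rewrite -[v]addr0; apply/wN/mem0v.
  rewrite scale1r scale0r add0r; split=> // x.
  by rewrite -[v]addr0; apply/wN/mem0v.
exists true, true; move: b; case: eqP => _ /= b; rewrite !scale1r.
  by split=> //; apply: wN.
by split=> // x; rewrite addrC; apply: wN.
Qed.

End OnePencil.

(** * Reduction of a rigid pencil to one of smaller dimension *)

Lemma subvs_dim (A : vectType k) (W : {vspace A}) :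
  \dim {: subvs_of W} = \dim W.
Proof. by rewrite dimvf. Qed.

Lemma prod_dim (A B : vectType k) :
  \dim {: (A * B)%type} = (\dim {: A} + \dim {: B})%N.
Proof. by rewrite !dimvf. Qed.

(** The induction lowers both dimensions by two. Modulo the image of [pencil_at i], where al_i v_j +
    be_i v_(j+2) = 0, the space V is spanned by v_0, v_1 if be_i <> 0, and by v_n, v_(n+1) if be_i =
    0; this is why the vector w is sought at the offset o. *)
Theorem pencil_normal_form n (U V : vectType k) (p1 p2 : 'Hom(U, V))
    (S : {set I}) (psi : I -> 'Hom(V, k^o)) :
  (forall i, i \in S -> psi i != 0) ->
  separated p1 p2 S psi ->
  (forall i x, i \in S -> psi i (pencil_at p1 p2 i x) = 0) ->
  rigid_pencil p1 p2 -> \dim {:U} = n -> \dim {:V} = n.+2 ->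
  normal_form p1 p2 S psi n.
Proof.
elim/ltn_ind: n U V p1 p2 S psi => n IH U V p1 p2 S psi psi0 sep psiP rig dU dV.
case: n IH dU dV => [|[|n]] IH dU dV.
- exact: normal_form0.
- exact: normal_form1.
(* The other alternative would mean 2 (n + 2) < n + 4. *)
have onto : (limg p1 + limg p2 = fullv)%VS.
  by case: (rigid_pencil_dim rig) => // -[_]; rewrite dU dV; lia.
have VP y : exists a b, y = p1 a + p2 b.
  have : y \in (limg p1 + limg p2)%VS by rewrite onto memvf.
  case/memv_addP=> _ /memv_imgP[a _ ->] [_ /memv_imgP[b _ ->] ->].
  by exists a, b.
(* The pencil is determined by the pencil (f1, f2) : lker q -> U of smaller
   dimension, where p2 \o f1 = p1 \o f2; the functional psi i on V becomes its
   composite with one of p1 and p2 that is not proportional to pencil_at i. *)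
have [q qE] : {q : 'Hom((U * U)%type, V) | forall x, q x = p2 x.1 - p1 x.2}.
  apply: lfun_ex => c x y.
  by rewrite !linearP /= scalerDr addrACA.
have qfull : limg q = fullv.
  apply/vspaceP => y; rewrite memvf; have [a [b ->]] := VP y.
  have -> : p1 a + p2 b = q (b, - a) by rewrite qE /= linearN opprK addrC.
  by rewrite memv_img // memvf.
pose U' : vectType k := subvs_of (lker q).
have dU' : \dim {: U'} = n.
  have := limg_ker_dim q fullv.
  by rewrite capfv qfull prod_dim subvs_dim dU dV; lia.
have [f1 f1E] : {f : 'Hom(U', U) | forall x, f x = (vsval x).1}.
  by apply: lfun_ex => c x y; rewrite linearP.
have [f2 f2E] : {f : 'Hom(U', U) | forall x, f x = (vsval x).2}.
  by apply: lfun_ex => c x y; rewrite linearP.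
have p21 x : p2 (f1 x) = p1 (f2 x).
  have := subvsP x; rewrite memv_ker qE => /eqP/eqP.
  by rewrite subr_eq0 f1E f2E => /eqP.
have lift a b : p2 a = p1 b -> exists x, f1 x = a /\ f2 x = b.
  move=> ab; have abq : (a, b) \in lker q by rewrite memv_ker qE /= ab subrr.
  by exists (Subvs abq); rewrite f1E f2E.
pose psi' i : 'Hom(U, k^o) := (psi i \o (if be i == 0 then p2 else p1))%VF.
have psi'E i x : psi' i x = psi i ((if be i == 0 then p2 else p1) x).
  by rewrite /psi' comp_lfunE.
have span_i i y : exists a b,
    y = pencil_at p1 p2 i a + (if be i == 0 then p2 else p1) b.
  have [a [b ->]] := VP y; rewrite /pencil_at; case: eqP => [bi|/eqP bi].
    exists ((al i)^-1 *: a), b.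
    by rewrite lfunZ bi scale0r addr0 scalerA mulfV ?scale1r // ab_neq0.
  exists ((be i)^-1 *: b), (a - (al i / be i) *: b).
  rewrite !lfunZ lfunBZ !scalerA mulfV // scale1r addrACA addrC.
  by rewrite addrA subrK addrC.
have psi'0 i : i \in S -> psi' i != 0.
  move=> iS; apply: contraNneq (psi0 i iS) => e; apply/eqP/lfunP => y.
  have [a [b ->]] := span_i i y.
  by rewrite linearD /= psiP // -psi'E e !zero_lfunE addr0.
(* Since psi_i vanishes on the image of [pencil_at i], its eigenvector property has to be tested
   only on the image of the other map, where it is that of psi'_i. *)
have eig_iff i gU gV : i \in S -> pencil_endo p1 p2 gU gV ->
    eigen gV (psi i) <-> eigen gU (psi' i).
  move=> iS [g1 g2]; split=> -[c gc]; exists c => x.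
    by rewrite !psi'E -gc; congr (psi i _); case: ifP.
  have [a [b ->]] := span_i i x.
  have -> : gV (pencil_at p1 p2 i a + (if be i == 0 then p2 else p1) b) =
      pencil_at p1 p2 i (gU a) + (if be i == 0 then p2 else p1) (gU b).
    rewrite linearD /= {1}/pencil_at linearD /= !lfunZ -g1 -g2; congr (_ + _).
    by case: ifP.
  have lin y z : psi i (pencil_at p1 p2 i y + z) = psi i z.
    by rewrite linearD /= psiP // add0r.
  by rewrite !lin -!psi'E.
have sep' : separated f1 f2 S psi'.
  (* An endomorphism (gU, gV) induces one of the reduced pencil: gU in both components on lker q,
     and gU on U. *)
  move=> i iS; have [gU [gV [gP eig neig]]] := sep i iS.
  have stab x : (gU (f1 x), gU (f2 x)) \in lker q.
    by rewrite memv_ker qE /= gP.1 gP.2 p21 subrr.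
  have [h hE] : {h : 'End(U') | forall x, h x = vsproj _ (gU (f1 x), gU (f2 x))}.
    apply: lfun_ex => c x y; rewrite -linearP; congr (vsproj _ _).
    by rewrite !linearP.
  exists h, gU; split.
  - split=> x; rewrite hE.
      by rewrite f1E vsprojK.
    by rewrite f2E vsprojK.
  - by move=> j jS ji; apply/(eig_iff _ _ _ jS gP); apply: eig.
  by move/(eig_iff _ _ _ iS gP).
have psiP' i x : i \in S -> psi' i (pencil_at f1 f2 i x) = 0.
  move=> iS; rewrite psi'E.
  have -> : (if be i == 0 then p2 else p1) (pencil_at f1 f2 i x) =
      pencil_at p1 p2 i ((if be i == 0 then f2 else f1) x).
    rewrite /pencil_at; case: ifP => _; rewrite linearD /= !lfunZ.
      by rewrite p21.
    by rewrite p21.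
  exact: psiP.
have rig' : rigid_pencil f1 f2.
  move=> D1 D2.
  (* A deformation (D1, D2) of the reduced pencil fails the relation p2 f1 = p1 f2 by X. Extending X
     from lker q to U x U and splitting it into components gives a deformation (E1, E2) of (p1, p2);
     its trivialization corrects (D1, D2) so that the result lands in lker q, and this yields h. *)
  have [X XE] : {X : 'Hom(U', V) | forall x, X x = p1 (D2 x) - p2 (D1 x)}.
    by apply: lfun_ex => c x y; rewrite !linearP /= scalerDr addrACA.
  have [j jE] : {j : 'Hom(U', (U * U)%type) | forall x, j x = vsval x}.
    by apply: lfun_ex => c x y; rewrite linearP.
  have FE x : (X \o j^-1)%VF (f1 x, f2 x) = X x.
    rewrite (_ : (_, _) = j x); last by rewrite jE f1E f2E; case: (vsval x).
    apply: factor_ker => y; rewrite jE => y0.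
    have -> : y = 0 by apply: subvs_inj; rewrite y0 linear0.
    by rewrite linear0.
  move: (X \o j^-1)%VF FE => F FE.
  have [E2 E2E] : {E : 'Hom(U, V) | forall x, E x = F (x, 0)}.
    apply: lfun_ex => c x y; rewrite -linearP; congr (F _).
    by transitivity (c *: x + y, c *: (0 : U) + 0); first by rewrite scaler0 addr0.
  have [E1 E1E] : {E : 'Hom(U, V) | forall x, E x = - F (0, x)}.
    apply: lfun_ex => c x y; rewrite scalerN -opprD -linearP.
    congr (- F _).
    by transitivity (c *: (0 : U) + 0, c *: x + y); first by rewrite scaler0 addr0.
  have [gU [gV [e1 e2]]] := rig E1 E2.
  have stab x : (D1 x + gU (f1 x), D2 x + gU (f2 x)) \in lker q.
    have key : p1 (D2 x) - p2 (D1 x) = p2 (gU (f1 x)) - p1 (gU (f2 x)).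
      rewrite -XE -FE.
      have -> : F (f1 x, f2 x) = E2 (f1 x) - E1 (f2 x).
        rewrite E2E E1E opprK -linearD; congr (F _).
        by transitivity (f1 x + 0, 0 + f2 x); first by rewrite addr0 add0r.
      by rewrite e1 e2 p21 opprB addrA subrK.
    have lin (f : 'Hom(U, V)) y z : f (y + z) = f y + f z by rewrite linearD.
    rewrite memv_ker qE !lin opprD addrACA -[X in _ + X]key.
    by rewrite -opprB addNr.
  have [h hE] : {h : 'End(U') | forall x,
      h x = vsproj _ (D1 x + gU (f1 x), D2 x + gU (f2 x))}.
    apply: lfun_ex => c x y; rewrite -linearP; congr (vsproj _ _).
    by rewrite !linearP /=; congr (_, _); rewrite addrACA -scalerDr.
  exists h, gU; split=> x; rewrite hE.
    by rewrite [f1 (vsproj _ _)]f1E vsprojK //= addrK.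
  by rewrite [f2 (vsproj _ _)]f2E vsprojK //= addrK.
have [us' [us [e1 e2 spU' spU spec]]] :=
  IH n (leqW (ltnSn n)) U' U f1 f2 S psi' psi'0 sep' psiP' rig' dU' dU.
have comm j : (j < n)%N -> p2 (us j) = p1 (us j.+2).
  by move=> jn; rewrite -e1 // -e2 // p21.
(* The target basis us of the reduced pencil becomes the source basis. The last two vectors of vs
   come from p2, and [comm] makes both descriptions agree where they overlap. *)
pose vs j := if (j < n.+2)%N then p1 (us j) else p2 (us j.-2).
have vs1 j : (j < n.+2)%N -> p1 (us j) = vs j by rewrite /vs => ->.
have vs2 j : (j < n.+2)%N -> p2 (us j) = vs j.+2.
  by rewrite /vs !ltnS => jn; case: ltnP => // /comm.
exists us, vs; split=> //.
  apply/eqP; rewrite eqEsubv subvf -onto subv_add -spU !limg_span.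
  apply/and3P; split=> //; apply/span_subvP => _ /mapP[_ /mapP[j jn ->] ->].
    rewrite mem_iota in jn; rewrite vs1 // memv_span //.
    by apply: map_f; rewrite mem_iota; lia.
  rewrite mem_iota in jn; rewrite vs2 // memv_span //.
  by apply: map_f; rewrite mem_iota; lia.
move=> i iS; have [c [d]] := spec i iS; move=> /= [w0 wN].
set o := (if be i == 0 then n.+2 else 0%N).
exists c, d.
(* The coefficients c and d carry over: p1 keeps the offset 0, while p2 shifts the offset n to n +
   2. *)
have ew : c%:R *: vs o + d%:R *: vs o.+1 =
   (if be i == 0 then p2 else p1) (c%:R *: us (if be i == 0 then n else 0%N)
      + d%:R *: us (if be i == 0 then n else 0%N).+1).
  by rewrite /o; case: ifP => _; rewrite linearD /= !lfunZ ?vs1 ?vs2.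
rewrite ew; set w := (X in psi' i X = 0) in w0.
rewrite -/w in wN *; split; first by rewrite -psi'E.
(* If the image of w were in the image of [pencil_at i], the equation would yield an element of lker
   q at which the reduced pencil takes the value w. *)
move=> x; apply/eqP; rewrite /pencil_at; case: eqP => [bi|/eqP bi] e.
  have [y [y1 y2]] : exists y, f1 y = (al i)^-1 *: w /\ f2 y = x.
    apply: lift; rewrite lfunZ e bi scale0r addr0 scalerA mulVf ?scale1r //.
    exact: ab_neq0.
  case/eqP: (wN y); rewrite /pencil_at y1 y2 bi scale0r addr0 scalerA.
  by rewrite mulfV ?scale1r // ab_neq0.
have [y [y1 y2]] : exists y, f1 y = x /\ f2 y = (be i)^-1 *: (w - al i *: x).
  apply: lift; rewrite lfunZ lfunBZ e [X in X - _]addrC addrK scalerA.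
  by rewrite mulVf ?scale1r.
case/eqP: (wN y); rewrite /pencil_at y1 y2 scalerA mulfV // scale1r.
by rewrite addrC subrK.
Qed.

End Pencil.

(** * Arms of a module *)

(** Downward recursion in a family of types. Induction on p peels off the index 0 and shifts T, so
    no transport between types occurs; defaults fill the indices beyond p. *)
Lemma descending_chain p (T : nat -> Type) (st : forall l, (l < p)%N -> T l.+1 -> T l)
    (x : T p) (dflt : forall l, T l) :
  {s : forall l, T l | s p = x & forall l (h : (l < p)%N), s l = st l h (s l.+1)}.
Proof.
elim: p T st x dflt => [|p IH] T st x dflt.
  by exists (fun l => if l is l'.+1 then dflt l'.+1 else x).
have [s sp sS] := IH (T \o S) (fun l h => st l.+1 h) x (fun l => dflt l.+1).
exists (fun l => if l is l'.+1 then s l' else st 0%N (ltn0Sn p) (s 0%N)) => //.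
case=> [|l] h; last exact: sS.
by congr (st _ _ _); exact: bool_irrelevance.
Qed.

Section Arms.
Variables (k : fieldType) (L : canonical_datum k).
Implicit Types (i : 'I_(arms L)) (l : nat).
Notation av := (@arm_vertex k L).

Lemma arm_vertexS i (m : 'I_(weight i).-1) : av i m.+1 = Inner m.
Proof. by rewrite /= valK. Qed.

Lemma weight_gt0 i : (0 < weight i)%N.
Proof. exact: ltnW (weight_ge2 i). Qed.

Lemma vertexP (v : vertex L) : exists i l, (l <= weight i)%N /\ v = av i l.
Proof.
case: v => [|i m|].
- by exists (arm1 L), 0%N.
- exists i, m.+1; rewrite arm_vertexS; split=> //.
  by rewrite (leq_trans (ltn_ord m)) // leq_pred.
by exists (arm1 L), (weight (arm1 L)); rewrite arm_vertex_weight.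
Qed.

(** Data given level by level on each arm define data on all vertices once they agree at the two
    common ones. The last vertex of an arm is only provably equal to [Top], hence the transport. *)
Lemma glue (T : vertex L -> Type) (F : forall i l, T (av i l))
    (z : T (Zero L)) (y : T (Top L)) :
    (forall i, F i 0%N = z) ->
    (forall i, eq_rect _ T (F i (weight i)) _ (arm_vertex_weight i) = y) ->
  {h : forall v, T v | [/\ h (Zero L) = z, h (Top L) = y &
    forall i l, (l <= weight i)%N -> h (av i l) = F i l]}.
Proof.
move=> F0 Fp.
pose h v : T v := match v with
  | Zero => z
  | Inner i m => eq_rect _ T (F i m.+1) _ (arm_vertexS m)
  | Top => y end.
have eq_inj v w (e : v = w) (t : T v) : h w = eq_rect _ T t _ e -> h v = t.
  by case: _ / e.
exists h; split=> // i [|l] lp; first by rewrite F0.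
have [lt|ge] := ltnP l (weight i).-1.
  exact: (eq_inj _ _ (arm_vertexS (Ordinal lt))).
have le : l.+1 = weight i.
  by apply/eqP; rewrite eqn_leq lp -(prednK (weight_gt0 i)) ltnS.
by rewrite le; apply: (eq_inj _ _ (arm_vertex_weight i)).
Qed.

Section Raw.
Variable (X : vertex L -> vectType k).

(** Transport between equal vertices as a linear map, so that it composes with the other maps. *)
Definition cast_lfun v w (e : v = w) : 'Hom(X v, X w) :=
  eq_rect v (fun w => 'Hom(X v, X w)) \1%VF w e.

Lemma cast_lfunK v w (e : v = w) : cancel (cast_lfun e) (cast_lfun (esym e)).
Proof. by case: _ / e => x; rewrite !id_lfunE. Qed.

Lemma cast_lfunVK v w (e : v = w) : cancel (cast_lfun (esym e)) (cast_lfun e).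
Proof. by case: _ / e => x; rewrite !id_lfunE. Qed.

Definition top_cast i : 'Hom(X (Top L), X (av i (weight i))) :=
  cast_lfun (esym (arm_vertex_weight i)).

Definition top_uncast i : 'Hom(X (av i (weight i)), X (Top L)) :=
  cast_lfun (arm_vertex_weight i).

Lemma top_castK i : cancel (top_cast i) (top_uncast i).
Proof. exact: cast_lfunVK. Qed.

Lemma top_uncastK i : cancel (top_uncast i) (top_cast i).
Proof. exact: cast_lfunK. Qed.

Variable (a : forall i (m : 'I_(weight i)), 'Hom(X (av i m.+1), X (av i m))).

(** Indexed by all natural numbers and zero past the end of the arm, which frees inductions on
    levels from ordinals. *)
Definition arrow i l : 'Hom(X (av i l.+1), X (av i l)) :=
  match @idP (l < weight i)%N with
  | ReflectT h => a (Ordinal h)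
  | ReflectF _ => 0
  end.

Lemma arrowE i (m : 'I_(weight i)) : arrow i m = a m.
Proof.
rewrite /arrow; case: {-}_ / idP => [h|]; last by case: m.
by case: m h => m h h'; rewrite (bool_irrelevance h' h).
Qed.

Lemma arrow_geq i l : (weight i <= l)%N -> arrow i l = 0.
Proof.
by rewrite leqNgt => /negP h; rewrite /arrow; case: {-}_ / idP => // h'; case: (h h').
Qed.

(** The action of the path from 0 to l x_i, with values in M_0; its counterpart [down] starts at
    M_c, and the two compose to the action of the arm. *)
Definition up i l : 'Hom(X (av i l), X (Zero L)) :=
  match @idP (l <= weight i)%N with
  | ReflectT h => arm_map_upto a h
  | ReflectF _ => 0
  end.

Lemma upE i l (h : (l <= weight i)%N) : up i l = arm_map_upto a h.
Proof.
rewrite /up; case: {-}_ / idP => [h'|//].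
by rewrite (bool_irrelevance h' h).
Qed.

Lemma up0 i : up i 0 = \1%VF.
Proof. by rewrite (upE (leq0n _)). Qed.

Lemma upS i l x : (l < weight i)%N -> up i l.+1 x = up i l (arrow i l x).
Proof.
move=> h; rewrite (upE h) (upE (ltnW h)) /= comp_lfunE.
by rewrite (arrowE (Ordinal h)).
Qed.

Lemma arm_mapE i x : arm_map a i x = up i (weight i) (top_cast i x).
Proof.
rewrite (upE (leqnn _)) /arm_map /top_cast.
move: (arm_map_upto _ _) => f; case: _ / (arm_vertex_weight i) f x => f x.
by rewrite id_lfunE.
Qed.

Fact down_key i : {q : forall l, 'Hom(X (Top L), X (av i l)) |
  q (weight i) = top_cast i &
  forall l (h : (l < weight i)%N), q l = (arrow i l \o q l.+1)%VF}.
Proof.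
exact: (@descending_chain _ (fun l => 'Hom(X (Top L), X (av i l)))
  (fun l _ f => (arrow i l \o f)%VF) (top_cast i) (fun _ => 0)).
Qed.

Definition down i l : 'Hom(X (Top L), X (av i l)) := s2val (down_key i) l.

Lemma down_weight i : down i (weight i) = top_cast i.
Proof. exact: (s2valP (down_key i)). Qed.

Lemma downS i l x : (l < weight i)%N -> down i l x = arrow i l (down i l.+1 x).
Proof. by move=> h; rewrite /down (s2valP' (down_key i) l h) comp_lfunE. Qed.

(** The tool for computing [down], and with it the action of an arm: exhibit a family compatible
    with the arrows. *)
Lemma down_unique i (s : forall l, X (av i l)) x :
    s (weight i) = top_cast i x ->
    (forall l, (l < weight i)%N -> s l = arrow i l (s l.+1)) ->
  forall l, (l <= weight i)%N -> s l = down i l x.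
Proof.
move=> sp sS l lp; rewrite -(subKn lp); elim: (weight i - l)%N => [|d IH].
  by rewrite subn0 down_weight.
(* Beyond the weight the truncated subtraction makes both indices 0. *)
have [dp|dp] := ltnP d (weight i); last first.
  have e : (weight i - d.+1 = weight i - d)%N by lia.
  by rewrite e.
have lt : (weight i - d.+1 < weight i)%N by lia.
rewrite sS // downS //; congr (arrow _ _ _).
by have -> : (weight i - d.+1).+1 = (weight i - d)%N by lia.
Qed.

Lemma up_down i l x : (l <= weight i)%N -> up i l (down i l x) = arm_map a i x.
Proof.
move=> lp; rewrite arm_mapE -down_weight.
pose g l' := up i l' (down i l' x); rewrite -/(g l) -/(g (weight i)).
rewrite -(subKn lp); elim: (weight i - l)%N => [|d IH]; first by rewrite subn0.
have [dp|dp] := ltnP d (weight i); last first.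
  by have -> : (weight i - d.+1 = weight i - d)%N by lia.
have lt : (weight i - d.+1 < weight i)%N by lia.
rewrite -IH {1}/g downS // -upS // -/(g _.+1); congr g; lia.
Qed.

Lemma down0 i x : down i 0 x = arm_map a i x.
Proof. by rewrite -(up_down x (leq0n _)) up0 id_lfunE. Qed.

End Raw.
End Arms.

(** * Homomorphisms and the coefficients of the arms *)

Section Homs.
Variables (k : fieldType) (L : canonical_datum k).
Implicit Types (i j : 'I_(arms L)) (l : nat) (M N P : cmodule L).
Notation av := (@arm_vertex k L).

Section RawHom.
Variables (X Y : vertex L -> vectType k).
Variables (a : forall i (m : 'I_(weight i)), 'Hom(X (av i m.+1), X (av i m))).
Variables (b : forall i (m : 'I_(weight i)), 'Hom(Y (av i m.+1), Y (av i m))).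
Variable (f : forall v, 'Hom(X v, Y v)).
Hypothesis nat_f : forall i (m : 'I_(weight i)) x,
  f (av i m) (a m x) = b m (f (av i m.+1) x).

Lemma hom_arrow i l x : f (av i l) (arrow a i l x) = arrow b i l (f (av i l.+1) x).
Proof.
have [h|h] := ltnP l (weight i); last first.
  by rewrite !arrow_geq // !zero_lfunE linear0.
by rewrite (arrowE a (Ordinal h)) (arrowE b (Ordinal h)); exact: (@nat_f i (Ordinal h) x).
Qed.

Lemma hom_up i l x : (l <= weight i)%N ->
  f (Zero L) (up a i l x) = up b i l (f (av i l) x).
Proof.
elim: l x => [|l IH] x lp; first by rewrite !up0 !id_lfunE.
by rewrite !upS // IH 1?ltnW // hom_arrow.
Qed.

Lemma hom_cast v w (e : v = w) x :
  f w (cast_lfun X e x) = cast_lfun Y e (f v x).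
Proof. by case: _ / e; rewrite !id_lfunE. Qed.

(** Stated for raw families of maps, because it serves to prove the canonical relations of a
    kernel. *)
Lemma hom_arm_map i x : f (Zero L) (arm_map a i x) = arm_map b i (f (Top L) x).
Proof. by rewrite !arm_mapE hom_up // hom_cast. Qed.

End RawHom.

Lemma cmod_hom_nat M N (f : cmod_hom M N) i (m : 'I_(weight i)) x :
  f (av i m) (act M m x) = act N m (f (av i m.+1) x).
Proof. by have /lfunP/(_ x) := hom_natural f m; rewrite !comp_lfunE. Qed.

Fact mk_hom_key M N (f : forall v, 'Hom(M v, N v)) :
    (forall i (m : 'I_(weight i)) x,
      f (av i m) (act M m x) = act N m (f (av i m.+1) x)) ->
  {g : cmod_hom M N | forall v, g v = f v}.
Proof.
move=> nat_f; have nat' i (m : 'I_(weight i)) :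
    (f (av i m) \o act M m = act N m \o f (av i m.+1))%VF.
  by apply/lfunP => x; rewrite !comp_lfunE nat_f.
by exists (CModHom nat').
Qed.

Lemma build_hom M N (F : forall i l, 'Hom(M (av i l), N (av i l)))
    (fV : 'Hom(M (Zero L), N (Zero L))) (fU : 'Hom(M (Top L), N (Top L))) :
    (forall i, F i 0%N = fV) ->
    (forall i x, F i (weight i) (top_cast M i x) = top_cast N i (fU x)) ->
    (forall i l x, (l < weight i)%N ->
      F i l (arrow (act M) i l x) = arrow (act N) i l (F i l.+1 x)) ->
  {f : cmod_hom M N | [/\ f (Zero L) = fV, f (Top L) = fU &
    forall i l, (l <= weight i)%N -> f (av i l) = F i l]}.
Proof.
move=> F0 Fp FS.
have Fp' i : eq_rect _ (fun v => 'Hom(M v, N v)) (F i (weight i)) _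
    (arm_vertex_weight i) = fU.
  have gen v w (e : v = w) (f : 'Hom(M v, N v)) (g : 'Hom(M w, N w)) :
    (forall x, f (cast_lfun M (esym e) x) = cast_lfun N (esym e) (g x)) ->
    eq_rect v (fun v => 'Hom(M v, N v)) f w e = g.
    by case: _ / e g => g h; apply/lfunP => x; have := h x; rewrite !id_lfunE.
  exact: gen (Fp i).
have [h [h0 hp hF]] := glue F0 Fp'.
have [|g gE] := @mk_hom_key M N h.
  move=> i m x; rewrite !hF ?(ltnW (ltn_ord m)) //.
  by rewrite -!arrowE FS.
by exists g; split=> [||i l lp]; rewrite gE // hF.
Qed.

Lemma comp_hom M N P (g : cmod_hom N P) (f : cmod_hom M N) :
  {h : cmod_hom M P | forall v, h v = (g v \o f v)%VF}.
Proof. by apply: mk_hom_key => i m x; rewrite !comp_lfunE !cmod_hom_nat. Qed.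

(* The coefficients in arm_map i = arm_al i *: arm_map arm1 + arm_be i *: arm_map arm2. *)
Definition arm_al i : k := if i == arm2 L then 0 else 1.
Definition arm_be i : k :=
  if i == arm1 L then 0 else if i == arm2 L then 1 else param i.

Lemma arm12 : arm1 L != arm2 L. Proof. by []. Qed.

Lemma arm_cases i : [\/ i = arm1 L, i = arm2 L | (2 <= i)%N].
Proof.
case: i => [[|[|i]] h]; last by constructor 3.
  by constructor 1; apply: val_inj.
by constructor 2; apply: val_inj.
Qed.

Lemma arm_ge2 i : (2 <= i)%N -> (i != arm1 L) /\ (i != arm2 L).
Proof. by move=> h; split; apply/eqP => e; rewrite e in h. Qed.

Lemma arm_coef1 : arm_al (arm1 L) = 1 /\ arm_be (arm1 L) = 0.
Proof. by rewrite /arm_al /arm_be eqxx (negPf arm12). Qed.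

Lemma arm_coef2 : arm_al (arm2 L) = 0 /\ arm_be (arm2 L) = 1.
Proof. by rewrite /arm_al /arm_be eqxx eq_sym (negPf arm12). Qed.

Lemma arm_coef_ge2 i : (2 <= i)%N -> arm_al i = 1 /\ arm_be i = param i.
Proof. by case/arm_ge2=> /negPf h1 /negPf h2; rewrite /arm_al /arm_be h1 h2. Qed.

Lemma canonical_relE M i x : arm_map (act M) i x =
  arm_al i *: arm_map (act M) (arm1 L) x + arm_be i *: arm_map (act M) (arm2 L) x.
Proof.
rewrite /arm_al /arm_be; case: (arm_cases i) => [->|->|h].
- by rewrite eqxx (negPf arm12) scale1r scale0r addr0.
- by rewrite eqxx eq_sym (negPf arm12) scale0r scale1r add0r.
have [/negPf-> /negPf->] := arm_ge2 h.
by rewrite canonical_rel // add_lfunE scale_lfunE scale1r.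
Qed.

Lemma arm_be0 i : arm_be i = 0 -> arm_al i != 0.
Proof.
rewrite /arm_al /arm_be; case: (arm_cases i) => [->|->|h].
- by rewrite (negPf arm12) oner_neq0.
- by rewrite eq_sym (negPf arm12) eqxx => /eqP; rewrite oner_eq0.
have [/negPf-> /negPf->] := arm_ge2 h.
by move/eqP; rewrite (negPf (param_neq0 h)).
Qed.

Lemma arm_det i j : i != j -> arm_al i * arm_be j != arm_al j * arm_be i.
Proof.
have n21 : (arm2 L == arm1 L) = false by rewrite eq_sym (negPf arm12).
rewrite /arm_al /arm_be; case: (arm_cases i) => [->|->|hi];
  case: (arm_cases j) => [->|->|hj]; rewrite ?eqxx ?(negPf arm12) ?n21 // => ij.
- by rewrite mulr1 mulr0 oner_eq0.
- have [/negPf-> /negPf->] := arm_ge2 hj.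
  by rewrite mul1r mulr0 param_neq0.
- by rewrite mulr1 mulr0 eq_sym oner_eq0.
- have [/negPf-> /negPf->] := arm_ge2 hj.
  by rewrite mul0r mulr1 eq_sym oner_eq0.
- have [/negPf-> /negPf->] := arm_ge2 hi.
  by rewrite !mul1r eq_sym param_neq0.
- have [/negPf-> /negPf->] := arm_ge2 hi.
  by rewrite mulr1 mul0r oner_eq0.
have [/negPf-> /negPf->] := arm_ge2 hi; have [/negPf-> /negPf->] := arm_ge2 hj.
by rewrite !mul1r; apply: contraNneq ij => /param_inj ->.
Qed.

End Homs.

(** * Projective modules *)

Section Projectives.
Variables (k : fieldType) (L : canonical_datum k).
Implicit Types (i j : 'I_(arms L)) (l : nat) (M N P : cmodule L).
Notation av := (@arm_vertex k L).

(* The module represents the functor N |-> N w. *)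
Record representable w := Representable {
  rep_mod :> cmodule L;
  rep_elt : rep_mod w;
  rep_gen : forall N (f g : cmod_hom rep_mod N), f w rep_elt = g w rep_elt ->
    forall v y, f v y = g v y;
  rep_hom : forall N (y : N w), {f : cmod_hom rep_mod N | f w rep_elt = y}
}.

(** By Yoneda, it is enough to lift the image of the generating element. *)
Lemma representable_projective w (P : representable w) : projective P.
Proof.
move=> M N q f epi_q.
have /memv_imgP[y _ ey] : f w (rep_elt P) \in limg (q w).
  by rewrite epi_q memvf.
have [g gy] := rep_hom P y; exists g => v; apply/lfunP => z.
have [h hE] := comp_hom q g; rewrite -hE; apply: rep_gen => {z}.
by rewrite hE comp_lfunE gy.
Qed.

Lemma row_sum1 d (y : 'rV[k]_d) : d = 1%N ->
  y = (\sum_c y 0 c) *: const_mx 1.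
Proof.
move=> e; subst d; apply/rowP => c.
by rewrite big_ord1 !mxE mulr1 ord1.
Qed.

Lemma row_eq0 d (y : 'rV[k]_d) : d = 0%N -> y = 0.
Proof. by move=> e; subst d; apply/rowP => -[]. Qed.

(** * Projectives at the vertex 0 and at the inner vertices *)

Section Simple.
Variables (i : 'I_(arms L)) (m : nat) (lt_m : (m < weight i)%N).

(* The projective at the vertex m x_i, of dimension one at the vertices
   l x_i with l <= m. *)
Definition sdim (v : vertex L) : nat :=
  match v with
  | Zero => 1
  | Inner j l => (j == i) && (l < m)%N
  | Top => 0
  end.

Lemma sdim_arm j l : (l < weight j)%N ->
  sdim (av j l) = (l == 0%N) || (j == i) && (l <= m)%N.
Proof.
case: l => [|l] lp //.
have lt : (l < (weight j).-1)%N by lia.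
by rewrite (arm_vertexS (Ordinal lt)).
Qed.

Lemma sdim_top j : sdim (av j (weight j)) = 0%N.
Proof. by rewrite arm_vertex_weight. Qed.

Definition sspace v : vectType k := 'rV[k]_(sdim v).

(** All spaces have dimension at most one, so the all-ones matrix is the identity between nonzero
    spaces and empty otherwise. *)
Definition sact j (l : 'I_(weight j)) : 'Hom(sspace (av j l.+1), sspace (av j l)) :=
  linfun (mulmxr (const_mx 1)).

Lemma sact_rel j : (2 <= j)%N ->
  arm_map sact j = arm_map sact (arm1 L) + param j *: arm_map sact (arm2 L).
Proof.
move=> _; apply/lfunP => x; rewrite (row_eq0 x erefl).
by rewrite linear0 [RHS]linear0.
Qed.

Definition smod := CModule sact_rel.

Lemma smod_actE j (l : 'I_(weight j)) (r : 'rV_(sdim (av j l.+1))) :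
  act smod l r = r *m const_mx 1.
Proof. exact: lfunE. Qed.

Lemma sact_const l : (l < m)%N ->
  arrow (act smod) i l (const_mx 1 : 'rV_(sdim (av i l.+1))) =
  (const_mx 1 : 'rV_(sdim (av i l))).
Proof.
move=> lm; have lp : (l < weight i)%N by lia.
have d1 : sdim (av i l.+1) = 1%N.
  by rewrite sdim_arm ?eqxx ?lm //; lia.
rewrite (arrowE (act smod) (Ordinal lp)).
apply: etrans (@smod_actE i (Ordinal lp) _) _; apply/rowP => c; rewrite !mxE.
under eq_bigr => d _ do rewrite !mxE mulr1.
by rewrite sumr_const card_ord d1.
Qed.

Lemma smod_gen N (f g : cmod_hom smod N) :
  f (av i m) (const_mx 1 : 'rV_(sdim (av i m))) =
  g (av i m) (const_mx 1 : 'rV_(sdim (av i m))) ->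
  forall v y, f v y = g v y.
Proof.
move=> e0.
have agree l : (l <= m)%N ->
    f (av i l) (const_mx 1 : 'rV_(sdim (av i l))) =
    g (av i l) (const_mx 1 : 'rV_(sdim (av i l))).
  move=> lm; rewrite -(subKn lm); elim: (m - l)%N => [|d IH].
    by rewrite subn0.
  have [dm|dm] := ltnP d m; last first.
    by have -> : (m - d.+1 = m - d)%N by lia.
  have lt : (m - d.+1 < m)%N by lia.
  rewrite -sact_const // !(hom_arrow (@cmod_hom_nat _ _ _ _ _)).
  have e : (m - d = (m - d.+1).+1)%N by lia.
  by rewrite e in IH; rewrite IH.
have zero v y : sdim v = 0%N -> f v y = g v y.
  by move=> v0; rewrite (row_eq0 y v0) !linear0.
have one v y : sdim v = 1%N ->
    f v (const_mx 1 : 'rV_(sdim v)) = g v (const_mx 1 : 'rV_(sdim v)) -> f v y = g v y.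
  by move=> v1 e; rewrite (row_sum1 y v1) !lfunZ e.
move=> v; have [j [l [lp ->]]] := vertexP v => y.
move: lp; rewrite leq_eqVlt => /predU1P[el|lp].
  by apply: zero; rewrite el sdim_top.
have := sdim_arm lp; case: l lp y => [|l] lp y.
  move=> _; apply: one => //; exact: (agree 0%N).
case: (eqVneq j i) => [ej|_] /=; last exact: (@zero (av _ _) y).
subst j; have [lm|lm] := leqP l.+1 m; last exact: (@zero (av i l.+1) y).
by move=> d1; apply: (@one (av i l.+1) y d1); apply: agree.
Qed.

Lemma smod_hom N (y : N (av i m)) : {f : cmod_hom smod N |
  f (av i m) (const_mx 1 : 'rV_(sdim (av i m))) = y}.
Proof.
have [s sm sS] := @descending_chain m (fun l => N (av i l))
  (fun l _ x => arrow (act N) i l x) y (fun _ => 0).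
(* The images of the basis vectors: y pushed down the arm i at the levels up to m, and zero at all
   other vertices except 0. *)
pose F j l : N (av j l) := match l return N (av j l) with
  | 0 => s 0%N
  | l'.+1 => match @eqP _ i j with
     | ReflectT e => eq_rect i (fun j => N (av j l'.+1))
          (if (l' < m)%N then s l'.+1 else 0) j e
     | ReflectF _ => 0 end end.
have Fi l : (l <= m)%N -> F i l = s l.
  case: l => // l lm; rewrite /F lm; case: eqP => // e.
  by rewrite (eq_axiomK e).
have F0 j l : (0 < l)%N -> ~~ ((j == i) && (l <= m)%N) -> F j l = 0.
  case: l => // l _; rewrite /F; case: eqP => // e.
  by case: _ / e; rewrite eqxx /= => /negPf->.
have cast0 (v w : vertex L) (e : v = w) :
  eq_rect v (fun v => N v) (0 : N v) w e = 0 by case: _ / e.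
have Fp j : eq_rect _ (fun v => N v) (F j (weight j)) _ (arm_vertex_weight j) = 0.
  rewrite F0 ?weight_gt0 ?cast0 //; apply/negP => /andP[/eqP-> le].
  by have := lt_m; rewrite ltnNge le.
have [t [t0 tp tF]] := glue (T := fun v => N v) (F := F) (fun=> erefl) Fp.
have [f fE] : {f : forall v, 'Hom(sspace v, N v) |
    forall v r, f v r = (\sum_c r 0 c) *: t v}.
  have f_ex v : {f : 'Hom(sspace v, N v) | forall r, f r = (\sum_c r 0 c) *: t v}.
    apply: lfun_ex => c x z; rewrite scalerA -scalerDl mulr_sumr -big_split /=.
    by congr (_ *: _); apply: eq_bigr => d _; rewrite !mxE.
  by exists (fun v => sval (f_ex v)) => v; exact: (svalP (f_ex v)).
have [|g gE] := @mk_hom_key _ _ smod N f.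
  move=> j l r; rewrite !fE.
  have [d0|d0] := eqVneq (sdim (av j l.+1)) 0%N.
    have -> : r = 0 by exact: row_eq0.
    rewrite linear0 !big1 ?scale0r ?linear0 // => c _; by rewrite mxE.
  have lp : (l.+1 < weight j)%N.
    rewrite ltn_neqAle ltn_ord andbT; apply: contraNneq d0 => el.
    by rewrite [X in av j X]el sdim_top.
  have /andP[ej lm] : (j == i) && (l < m)%N.
    by apply: contraNT d0 => /negPf h; rewrite sdim_arm // h.
  have d1 : sdim (av j l) = 1%N.
    by rewrite sdim_arm ?(ltnW lp) // ej (ltnW lm) orbT.
  rewrite !tF ?(ltnW lp) // ?(ltnW (ltnW lp)) // [RHS]lfunZ -(arrowE (act N) l).
  move/eqP in ej; subst j; rewrite !Fi // ?(ltnW lm) // sS //; congr (_ *: _).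
  under eq_bigr => c _.
    rewrite (@smod_actE i l) mxE; under eq_bigr => d _ do rewrite !mxE mulr1.
    over.
  by rewrite sumr_const card_ord d1.
exists g; rewrite gE fE tF 1?ltnW // Fi // sm.
rewrite (eq_bigr (fun=> 1)) => [|c _]; last by rewrite mxE.
by rewrite sumr_const card_ord sdim_arm // eqxx leqnn orbT scale1r.
Qed.

Definition srep := Representable smod_gen smod_hom.

End Simple.

(** * The projective at the top vertex *)

Section TopProjective.

(** Counts paths modulo the canonical relations: one at each vertex other than 0, and at 0 a plane
    with the paths along the first two arms as basis. *)
Definition tdim (v : vertex L) : nat := if v is Zero then 2 else 1.

Lemma tdimS j l : tdim (av j l.+1) = 1%N.
Proof. by rewrite /=; case: insub. Qed.

Definition tspace v : vectType k := 'rV[k]_(tdim v).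

(** At l = 0, the coordinates of the path along the arm j in the basis of the paths along the first
    two arms. *)
Definition tcoef j l (c : nat) : k :=
  if l is 0%N then if c is 0%N then arm_al j else arm_be j else 1.

Definition tact j (l : 'I_(weight j)) : 'Hom(tspace (av j l.+1), tspace (av j l)) :=
  linfun (mulmxr (\matrix_(a, c) tcoef j l c)).

Lemma tact_const j l (x : k) : (l < weight j)%N ->
  arrow tact j l (const_mx x : 'rV_(tdim (av j l.+1))) =
  ((\row_c (x * tcoef j l c)) : 'rV_(tdim (av j l))).
Proof.
move=> lp; rewrite (arrowE tact (Ordinal lp)) /tact.
apply: etrans (lfunE _ _) _; apply/rowP => c; rewrite !mxE.
under eq_bigr => d _ do rewrite !mxE.
by rewrite sumr_const card_ord (tdimS j l) mulr1n.
Qed.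

Lemma cast_const v w (e : v = w) (x : k) :
  cast_lfun tspace e (const_mx x : 'rV_(tdim v)) = (const_mx x : 'rV_(tdim w)).
Proof. by case: _ / e; rewrite id_lfunE. Qed.

Lemma tact_down j l (x : k) : (l < weight j)%N ->
  down tact j l.+1 (const_mx x : 'rV_(tdim (Top L))) =
  (const_mx x : 'rV_(tdim (av j l.+1))).
Proof.
move=> lp; symmetry.
pose s l : tspace (av j l) := if l is 0%N then \row_c (x * tcoef j 0 c)
  else const_mx x.
apply: (down_unique (s := s)) => //.
  rewrite /s /top_cast cast_const; move: (weight_gt0 j).
  by case: (weight j).
case=> [|l'] lp'; first by rewrite [in RHS]/s tact_const.
by rewrite [in RHS]/s tact_const // /s; apply/rowP => c; rewrite !mxE mulr1.
Qed.

Lemma tact_arm_map j (x : 'rV[k]_1) :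
  arm_map tact j x = \row_c (x 0 0 * tcoef j 0 c).
Proof.
have -> : x = (const_mx (x 0 0) : 'rV_(tdim (Top L))).
  by apply/rowP => c; rewrite !mxE ord1.
rewrite -down0 downS ?weight_gt0 // tact_down ?weight_gt0 // tact_const ?weight_gt0 //.
by apply/rowP => c; rewrite !mxE.
Qed.

Lemma tact_rel j : (2 <= j)%N ->
  arm_map tact j = arm_map tact (arm1 L) + param j *: arm_map tact (arm2 L).
Proof.
move=> j2; apply/lfunP => x; rewrite add_lfunE scale_lfunE !tact_arm_map.
apply/rowP => c; rewrite !mxE /tcoef.
have [-> ->] := arm_coef1 L; have [-> ->] := arm_coef2 L.
have [-> ->] := arm_coef_ge2 j2.
by case: c => -[|c] h /=; ring.
Qed.

Definition tmod := CModule tact_rel.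

Definition telt : tmod (Top L) := (const_mx 1 : 'rV_(tdim (Top L))).

Lemma tmod_gen N (f g : cmod_hom tmod N) :
  f (Top L) telt = g (Top L) telt -> forall v y, f v y = g v y.
Proof.
move=> e0.
have agree j l : (l <= weight j)%N -> f (av j l) (down tact j l telt) =
    g (av j l) (down tact j l telt).
  have hd (h : cmod_hom tmod N) : (l <= weight j)%N ->
      h (av j l) (down tact j l telt) = down (act N) j l (h (Top L) telt).
    move=> lp; apply: (down_unique (s := fun l => h (av j l) (down tact j l telt))) => //.
      by rewrite down_weight (hom_cast h).
    by move=> l' lp'; rewrite downS // (hom_arrow (@cmod_hom_nat _ _ _ _ h)).
  by move=> lp; rewrite !hd // e0.
move=> v; have [j [l [lp ->]]] := vertexP v => y.
case: l lp y => [|l] lp y; last first.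
  rewrite (row_sum1 y (tdimS j l)) !lfunZ; congr (_ *: _).
  by have := agree j l.+1 lp; rewrite tact_down.
have zero j' : f (Zero L) (\row_c (tcoef j' 0 c)) = g (Zero L) (\row_c (tcoef j' 0 c)).
  have := agree j' 0%N (leq0n _); rewrite down0 tact_arm_map.
  set r := \row_c _; set r' := \row_c _; suff -> : r = r' by [].
  by apply/rowP => c; rewrite !mxE mul1r.
have e1 := zero (arm1 L); have e2 := zero (arm2 L).
(* The rows of coefficients of the first two arms are the standard basis at 0. *)
have -> : y = y 0 0 *: (\row_c (tcoef (arm1 L) 0 c)) +
              y 0 1 *: (\row_c (tcoef (arm2 L) 0 c)) :> 'rV_2.
  apply/rowP => c; rewrite !mxE /tcoef.
  have [-> ->] := arm_coef1 L; have [-> ->] := arm_coef2 L.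
  case: c => -[|[|c]] h //=; rewrite !(mulr0, mulr1) ?addr0 ?add0r;
    by congr (y _ _); apply: val_inj.
by rewrite linearD [RHS]linearD /= !lfunZ e1 e2.
Qed.

Lemma tmod_hom N (y : N (Top L)) : {f : cmod_hom tmod N | f (Top L) telt = y}.
Proof.
pose phi j := arm_map (act N) j y.
(* The images of the basis vectors: the two basis paths act on y by the first two arms, and at the
   other levels y is pushed down. *)
pose F j l : 'I_(tdim (av j l)) -> N (av j l) :=
  match l return 'I_(tdim (av j l)) -> N (av j l) with
  | 0 => fun c => if c is Ordinal 0 _ then phi (arm1 L) else phi (arm2 L)
  | l'.+1 => fun _ => down (act N) j l'.+1 y end.
have castc (v w : vertex L) (e : v = w) (z : N v) :
    eq_rect v (fun v => 'I_(tdim v) -> N v) (fun _ => z) w e =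
    (fun _ => cast_lfun N e z) by case: _ / e; rewrite id_lfunE.
have Fp j : eq_rect _ (fun v => 'I_(tdim v) -> N v) (F j (weight j)) _
    (arm_vertex_weight j) = fun _ => y.
  have -> : F j (weight j) = fun _ => down (act N) j (weight j) y.
    by rewrite /F; move: (weight_gt0 j); case: (weight j).
  by rewrite castc down_weight -/(top_uncast N j) top_castK.
have [t [t0 tp tF]] := glue (T := fun v => 'I_(tdim v) -> N v) (F := F)
  (z := F (arm1 L) 0%N) (fun=> erefl) Fp.
have [f fE] : {f : forall v, 'Hom(tspace v, N v) |
    forall v r, f v r = \sum_c r 0 c *: t v c}.
  have f_ex v : {f : 'Hom(tspace v, N v) | forall r, f r = \sum_c r 0 c *: t v c}.
    apply: lfun_ex => c x z; rewrite scaler_sumr -big_split /=.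
    by apply: eq_bigr => d _; rewrite !mxE scalerDl scalerA.
  by exists (fun v => sval (f_ex v)) => v; exact: (svalP (f_ex v)).
have key j l : \sum_c ((\row_c (1 * tcoef j l c)) : 'rV_(tdim (av j l))) 0 c *: F j l c
    = down (act N) j l y.
  case: l => [|l].
    rewrite down0 canonical_relE big_ord_recl big_ord_recl big_ord0.
    by rewrite !mxE /tcoef /= !mul1r addr0.
  under eq_bigr => c _ do rewrite mxE mul1r scale1r.
  by rewrite sumr_const card_ord (tdimS j l).
have [|g gE] := @mk_hom_key _ _ tmod N f.
  move=> j l r; rewrite (row_sum1 r (tdimS j l)).
  move: (\sum_c _) => x; rewrite !lfunZ; congr (_ *: _); rewrite !fE.
  have -> : act tmod l (const_mx 1) = (\row_c (1 * tcoef j l c)) :> 'rV_(tdim (av j l)).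
    by rewrite -tact_const // arrowE.
  rewrite !tF //; last exact: ltnW.
  have -> : \sum_c (const_mx 1 : 'rV_(tdim (av j l.+1))) 0 c *: F j l.+1 c =
      down (act N) j l.+1 y.
    under eq_bigr => c _ do rewrite mxE scale1r.
    by rewrite sumr_const card_ord tdimS.
  rewrite -arrowE -downS //; exact: key.
exists g; rewrite gE fE tp.
under eq_bigr => c _ do rewrite mxE scale1r.
by rewrite sumr_const card_ord.
Qed.

Definition trep := Representable tmod_gen tmod_hom.

End TopProjective.
End Projectives.

(** * Projective resolutions and self-extensions *)

Section Resolutions.
Variables (k : fieldType) (L : canonical_datum k).
Implicit Types (i j : 'I_(arms L)) (l : nat) (M N P : cmodule L).
Notation av := (@arm_vertex k L).

(** * Extensions twisted by a deformation of the arrows *)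

Section Twist.
Variables (N1 N2 : cmodule L).
Variable (del : forall j l, 'Hom(N2 (av j l.+1), N1 (av j l))).
Variable (D : 'I_(arms L) -> 'Hom(N2 (Top L), N1 (Zero L))).
(* Since del vanishes on the image of Top except at the last arrow of an arm,
   D j is the deformation of the action of the whole arm j. *)
Hypothesis del0 : forall j y, del j 0 (down (act N2) j 1 y) = D j y.
Hypothesis delS : forall j l y, (l.+1 < weight j)%N ->
  del j l.+1 (down (act N2) j l.+2 y) = 0.
Hypothesis D_rel : forall j, (2 <= j)%N ->
  D j = D (arm1 L) + param j *: D (arm2 L).

Definition twspace v : vectType k := (N1 v * N2 v)%type.

(** The extension of N2 by N1 with upper triangular action: act N1 and act N2 on the diagonal, del
    off it. *)
Fact twact_key j (l : 'I_(weight j)) :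
  {f : 'Hom(twspace (av j l.+1), twspace (av j l)) |
   forall x, f x = (act N1 l x.1 + del j l x.2, act N2 l x.2)}.
Proof.
apply: lfun_ex => c x y; rewrite !linearP /=; congr (_, _).
by rewrite [LHS]addrACA -scalerDr.
Qed.

Definition twact j (l : 'I_(weight j)) := sval (twact_key l).

Lemma twactE j (l : 'I_(weight j)) x :
  twact l x = (act N1 l x.1 + del j l x.2, act N2 l x.2).
Proof. exact: (svalP (twact_key l)). Qed.

Lemma arrow_twact j l x : (l < weight j)%N -> arrow twact j l x =
  (arrow (act N1) j l x.1 + del j l x.2, arrow (act N2) j l x.2).
Proof.
move=> lt; rewrite (arrowE twact (Ordinal lt)) (arrowE (act N1) (Ordinal lt)).
rewrite (arrowE (act N2) (Ordinal lt)); exact: (twactE (l := Ordinal lt)).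
Qed.

Lemma cast_twspace v w (e : v = w) x : cast_lfun twspace e x =
  (cast_lfun N1 e x.1, cast_lfun N2 e x.2).
Proof. by case: _ / e; rewrite !id_lfunE; case: x. Qed.

Lemma tw_arm_map j x : arm_map twact j x =
  (arm_map (act N1) j x.1 + D j x.2, arm_map (act N2) j x.2).
Proof.
pose s l : twspace (av j l) := match l return twspace (av j l) with
  | 0 => (down (act N1) j 0 x.1 + D j x.2, down (act N2) j 0 x.2)
  | l'.+1 => (down (act N1) j l'.+1 x.1, down (act N2) j l'.+1 x.2) end.
rewrite -!down0 -[RHS]/(s 0%N); symmetry.
apply: (@down_unique _ _ _ twact j s x _ _ 0%N) => //.
  have -> : s (weight j) =
      (down (act N1) j (weight j) x.1, down (act N2) j (weight j) x.2).
    by rewrite /s; move: (weight_gt0 j); case: (weight j).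
  by rewrite !down_weight /top_cast cast_twspace.
case=> [|l] lp; rewrite arrow_twact //= -!downS //.
  by rewrite del0.
by rewrite delS // addr0.
Qed.

Lemma tw_rel j : (2 <= j)%N ->
  arm_map twact j = arm_map twact (arm1 L) + param j *: arm_map twact (arm2 L).
Proof.
move=> j2; apply/lfunP => x; rewrite add_lfunE scale_lfunE !tw_arm_map.
rewrite !(canonical_rel _ j2) D_rel // !add_lfunE !scale_lfunE.
by congr (_, _); rewrite [LHS]addrACA -scalerDr.
Qed.

Definition twisted_sum := CModule tw_rel.

Lemma twisted_fst v : {f : 'Hom(twisted_sum v, N1 v) | forall x, f x = x.1}.
Proof. by apply: lfun_ex => c x y; rewrite linearP. Qed.

Lemma twisted_proj : {q : cmod_hom twisted_sum N2 | forall v x, q v x = x.2}.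
Proof.
have q_ex v : {f : 'Hom(twisted_sum v, N2 v) | forall x, f x = x.2}.
  by apply: lfun_ex => c x y; rewrite linearP.
have [|q qE] := @mk_hom_key _ _ twisted_sum N2 (fun v => sval (q_ex v)).
  move=> j l x; rewrite (svalP (q_ex _)) [act _ _ _]twactE.
  by rewrite (svalP (q_ex _)).
by exists q => v x; rewrite qE (svalP (q_ex v)).
Qed.

End Twist.

(** Only the universal property is recorded, so later arguments never see the underlying pairs. *)
Record direct_sum N1 N2 := DirectSum {
  sum_mod :> cmodule L;
  sum_inl : cmod_hom N1 sum_mod;
  sum_inr : cmod_hom N2 sum_mod;
  sum_copair : forall N (f1 : cmod_hom N1 N) (f2 : cmod_hom N2 N),
    {f : cmod_hom sum_mod N | (forall v x, f v (sum_inl v x) = f1 v x) /\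
                              (forall v x, f v (sum_inr v x) = f2 v x)};
  sum_ext : forall N (f g : cmod_hom sum_mod N),
    (forall v x, f v (sum_inl v x) = g v (sum_inl v x)) ->
    (forall v x, f v (sum_inr v x) = g v (sum_inr v x)) ->
    forall v x, f v x = g v x
}.

(** The sum is the twisted extension with zero twist. *)
Lemma direct_sum_ex N1 N2 : direct_sum N1 N2.
Proof.
pose del j l : 'Hom(N2 (av j l.+1), N1 (av j l)) := 0.
pose D j : 'Hom(N2 (Top L), N1 (Zero L)) := 0.
have del0 j y : del j 0%N (down (act N2) j 1 y) = D j y by rewrite !zero_lfunE.
have delS j l y : (l.+1 < weight j)%N -> del j l.+1 (down (act N2) j l.+2 y) = 0.
  by rewrite zero_lfunE.
have D_rel j : (2 <= j)%N -> D j = D (arm1 L) + param j *: D (arm2 L).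
  by rewrite /D scaler0 addr0.
have i1_ex v : {f : 'Hom(N1 v, twspace N1 N2 v) | forall x, f x = (x, 0)}.
  apply: lfun_ex => c x y.
  by transitivity (c *: x + y, c *: (0 : N2 v) + 0); first by rewrite scaler0 addr0.
have i2_ex v : {f : 'Hom(N2 v, twspace N1 N2 v) | forall x, f x = (0, x)}.
  apply: lfun_ex => c x y.
  by transitivity (c *: (0 : N1 v) + 0, c *: x + y); first by rewrite scaler0 addr0.
have [|i1 i1E] := @mk_hom_key _ _ N1 (twisted_sum del0 delS D_rel)
    (fun v => sval (i1_ex v)).
  move=> j l x; rewrite !(svalP (i1_ex _)) [RHS]twactE /=.
  by rewrite !linear0 addr0.
have [|i2 i2E] := @mk_hom_key _ _ N2 (twisted_sum del0 delS D_rel)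
    (fun v => sval (i2_ex v)).
  move=> j l x; rewrite !(svalP (i2_ex _)) [RHS]twactE /=.
  by rewrite !linear0 zero_lfunE addr0.
exists (twisted_sum del0 delS D_rel) i1 i2 => N.
  move=> f1 f2.
  have f_ex v : {f : 'Hom(twspace N1 N2 v, N v) | forall x, f x = f1 v x.1 + f2 v x.2}.
    by apply: lfun_ex => c x y; rewrite !linearP /= addrACA -scalerDr.
  have [|f fE] := @mk_hom_key _ _ (twisted_sum del0 delS D_rel) N
      (fun v => sval (f_ex v)).
    move=> j l x; rewrite !(svalP (f_ex _)) [act _ _ _]twactE /=.
    by rewrite zero_lfunE addr0 !cmod_hom_nat linearD.
  exists f; split=> v x; rewrite fE (svalP (f_ex v)).
    by rewrite i1E (svalP (i1_ex v)) /= linear0 addr0.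
  by rewrite i2E (svalP (i2_ex v)) /= linear0 add0r.
move=> f g e1 e2 v x.
have -> : x = i1 v x.1 + i2 v x.2.
  rewrite i1E (svalP (i1_ex v)) i2E (svalP (i2_ex v)).
  by transitivity (x.1 + 0, 0 + x.2); first by rewrite addr0 add0r; case: x.
have lin (h : cmod_hom (twisted_sum del0 delS D_rel) N) y z :
  h v (y + z) = h v y + h v z by rewrite linearD.
by rewrite !lin e1 e2.
Qed.

Lemma direct_sum_projective N1 N2 (S : direct_sum N1 N2) :
  projective N1 -> projective N2 -> projective S.
Proof.
move=> pr1 pr2 M N q f epi_q.
have [f1 f1E] := comp_hom f (sum_inl S); have [f2 f2E] := comp_hom f (sum_inr S).
have [g1 g1E] := pr1 M N q f1 epi_q; have [g2 g2E] := pr2 M N q f2 epi_q.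
have [g [e1 e2]] := sum_copair S g1 g2; exists g => v; apply/lfunP => x.
have [h hE] := comp_hom q g; rewrite -hE; apply: sum_ext => {x}v x.
  by rewrite hE comp_lfunE e1 -(comp_lfunE (q v)) -g1E f1E comp_lfunE.
by rewrite hE comp_lfunE e2 -(comp_lfunE (q v)) -g2E f2E comp_lfunE.
Qed.

Lemma representable_at (v : vertex L) : representable v.
Proof.
case: v => [|i m|].
- exact: (srep (weight_gt0 (arm1 L))).
- rewrite -arm_vertexS; apply: srep.
  by have := ltn_ord m; have := weight_gt0 i; lia.
exact: trep.
Qed.

(** The predicate [ok] selects the elements that have to be reached, so that an epimorphism can be
    assembled from finitely many elements. *)
Definition partial_cover N (ok : forall v, N v -> Prop) :=
  {P : cmodule L & {f : cmod_hom P N | projective P /\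
     forall v y, ok v y -> y \in limg (f v)}}.

Lemma cover_cup N (ok1 ok2 : forall v, N v -> Prop) :
  partial_cover ok1 -> partial_cover ok2 ->
  partial_cover (fun v y => ok1 v y \/ ok2 v y).
Proof.
move=> [P1 [f1 [pr1 c1]]] [P2 [f2 [pr2 c2]]].
pose S := direct_sum_ex P1 P2; have [f [e1 e2]] := sum_copair S f1 f2.
exists S, f; split; first exact: direct_sum_projective.
move=> v y [/c1|/c2] /memv_imgP[x _ ->].
  by rewrite -e1 memv_img // memvf.
by rewrite -e2 memv_img // memvf.
Qed.

Lemma cover_elt N w (y : N w) (ok : forall v, N v -> Prop) :
  (forall v z, ok v z -> exists e : w = v, z = cast_lfun N e y) -> partial_cover ok.
Proof.
move=> okP; have [f fy] := rep_hom (representable_at w) y.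
exists (representable_at w), f; split; first exact: representable_projective.
move=> v z /okP[e ->]; case: _ / e; rewrite id_lfunE -fy.
by rewrite memv_img // memvf.
Qed.

Lemma cover_seq N w (ys : seq (N w)) :
  partial_cover (fun v z => exists (e : w = v) y, y \in ys /\ z = cast_lfun N e y).
Proof.
elim: ys => [|y ys IH].
  by apply: (@cover_elt N w 0) => v z [e [y []]].
have [P [f [prP c]]] := cover_cup IH (@cover_elt N w y
  (fun v z => exists e : w = v, z = cast_lfun N e y) (fun v z h => h)).
exists P, f; split=> // v z [e [y' [y's ->]]]; apply: c.
by move: y's; rewrite inE => /predU1P[->|y's]; [right; exists e | left; exists e, y'].
Qed.

Lemma cover_vertices N (s : seq ('I_(arms L) * nat)) :
  partial_cover (fun v (z : N v) => exists2 p, p \in s & v = av p.1 p.2).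
Proof.
elim: s => [|p s IH].
  by apply: (@cover_elt N (Zero L) 0) => v z [].
have [P [f [prP c]]] := cover_cup IH (cover_seq (vbasis {: N (av p.1 p.2)})).
exists P, f; split=> // v z [p' p's ev].
move: p's; rewrite inE => /predU1P[ep|p's]; last by apply: c; left; exists p'.
rewrite {}ep in ev; move: z; rewrite ev => z.
rewrite (coord_vbasis (memvf z)); apply: memv_suml => i _; apply: memvZ.
apply: c; right; exists erefl; eexists; split; last by rewrite id_lfunE.
by rewrite mem_nth // size_tuple.
Qed.

Record cover N := Cover {
  cov_mod : cmodule L;
  cov_hom : cmod_hom cov_mod N;
  cov_proj : projective cov_mod;
  cov_epi : cmod_epi cov_hom
}.

(** Every vertex is one of finitely many pairs of an arm and a level; one representable module is
    taken for each basis vector there. *)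
Lemma enough_projectives N : cover N.
Proof.
have [P [f [prP c]]] := cover_vertices N
  [seq (i, l) | i <- enum 'I_(arms L), l <- iota 0 (weight i).+1].
exists P f => // v; apply/vspaceP => z; rewrite memvf; apply: c.
have [i [l [lp ->]]] := vertexP v; exists (i, l) => //.
apply/allpairsPdep; exists i, l; rewrite mem_enum mem_iota add0n ltnS; split=> //.
Qed.

(** * Kernels *)

Section Kernel.
Variables (P N : cmodule L) (f : cmod_hom P N).

Definition kspace v : vectType k := subvs_of (lker (f v)).

Fact kval_key v : {g : 'Hom(kspace v, P v) | forall x, g x = vsval x}.
Proof. by apply: lfun_ex => c x y; rewrite linearP. Qed.

Definition kval v := sval (kval_key v).

Lemma kvalE v x : kval v x = vsval x.
Proof. exact: (svalP (kval_key v)). Qed.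

Lemma kval_inj v : injective (kval v).
Proof. by move=> x y; rewrite !kvalE; apply: subvs_inj. Qed.

Fact kact_key i (m : 'I_(weight i)) :
  {g : 'Hom(kspace (av i m.+1), kspace (av i m)) |
   forall x, kval _ (g x) = act P m (kval _ x)}.
Proof.
have [g gE] : {g : 'Hom(kspace (av i m.+1), kspace (av i m)) |
    forall x, g x = vsproj _ (act P m (kval _ x))}.
  by apply: lfun_ex => c x y; rewrite !linearP.
exists g => x; rewrite kvalE gE vsprojK // memv_ker cmod_hom_nat kvalE.
by have := subvsP x; rewrite memv_ker => /eqP->; rewrite linear0.
Qed.

Definition kact i (m : 'I_(weight i)) := sval (kact_key m).

Lemma kactE i (m : 'I_(weight i)) x : kval _ (kact m x) = act P m (kval _ x).
Proof. exact: (svalP (kact_key m)). Qed.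

Lemma kact_rel i : (2 <= i)%N ->
  arm_map kact i = arm_map kact (arm1 L) + param i *: arm_map kact (arm2 L).
Proof.
move=> i2; apply/lfunP => x; apply: kval_inj.
have e j := hom_arm_map (a := kact) (b := act P) (f := kval) kactE j x.
rewrite e canonical_rel // !add_lfunE !scale_lfunE lfunDZ !e.
by [].
Qed.

Definition kmod := CModule kact_rel.

Lemma kincl : {g : cmod_hom kmod P | forall v, g v = kval v}.
Proof. by apply: mk_hom_key => i m x; rewrite [LHS]kactE. Qed.

Lemma kincl_img v : limg (kval v) = lker (f v).
Proof.
apply/vspaceP => y; apply/memv_imgP/idP => [[x _ ->]|yK].
  by rewrite kvalE subvsP.
by exists (vsproj _ y); rewrite ?memvf // kvalE vsprojK.
Qed.

End Kernel.

Section Resolution.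
Variable M : cmodule L.

Fixpoint syzygy n : cmodule L :=
  if n is n'.+1 then kmod (cov_hom (enough_projectives (syzygy n'))) else M.

Definition syz_cover n := enough_projectives (syzygy n).

Definition syz_diff n :
  {d : cmod_hom (cov_mod (syz_cover n.+1)) (cov_mod (syz_cover n)) |
   forall v, d v = (sval (kincl (cov_hom (syz_cover n))) v \o
                    cov_hom (syz_cover n.+1) v)%VF} :=
  comp_hom (sval (kincl (cov_hom (syz_cover n)))) (cov_hom (syz_cover n.+1)).

Lemma syz_diff_img n v : limg (sval (syz_diff n) v) = lker (cov_hom (syz_cover n) v).
Proof.
rewrite (svalP (syz_diff n)) (svalP (kincl _)) limg_comp.
by rewrite (cov_epi (syz_cover n.+1)) kincl_img.
Qed.

Lemma syz_diff_ker n v :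
  lker (sval (syz_diff n) v) = lker (cov_hom (syz_cover n.+1) v).
Proof.
apply/vspaceP => x; rewrite !memv_ker (svalP (syz_diff n)) (svalP (kincl _)).
by rewrite comp_lfunE -(inj_eq (@kval_inj _ _ _ v)) linear0.
Qed.

(** [ext_vanishS] quantifies over resolutions, so it yields something only once one exists. *)
Lemma projective_resolution : proj_resolution M.
Proof.
apply: (@ProjResolution _ _ M (fun n => cov_mod (syz_cover n))
  (fun n => sval (syz_diff n)) (cov_hom (syz_cover 0))).
- by move=> n; apply: cov_proj.
- exact: (cov_epi (syz_cover 0)).
- by move=> v; rewrite syz_diff_img.
by move=> n v; rewrite syz_diff_img syz_diff_ker.
Qed.

End Resolution.

Section Splitting.
Variable M : cmodule L.
Variable (del : forall j l, 'Hom(M (av j l.+1), M (av j l))).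
Variable (D : 'I_(arms L) -> 'Hom(M (Top L), M (Zero L))).

(* The extension of M by itself twisted by del splits, and h is the first
   component of a section. *)
Lemma ext_vanish_split :
    (forall j y, del j 0 (down (act M) j 1 y) = D j y) ->
    (forall j l y, (l.+1 < weight j)%N -> del j l.+1 (down (act M) j l.+2 y) = 0) ->
    (forall j, (2 <= j)%N -> D j = D (arm1 L) + param j *: D (arm2 L)) ->
    ext_vanishS 0 M M ->
  exists h : forall v, 'End(M v), forall j l x, (l < weight j)%N ->
    del j l x = h (av j l) (arrow (act M) j l x)
                - arrow (act M) j l (h (av j l.+1) x).
Proof.
move=> del0 delS D_rel ext; pose E := twisted_sum del0 delS D_rel.
have [q qE] := twisted_proj del0 delS D_rel.
have epi_q : cmod_epi q.
  move=> v; apply/vspaceP => y; rewrite memvf; apply/memv_imgP.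
  by exists ((0, y) : E v); rewrite ?memvf ?qE.
pose R := projective_resolution M.
(* The augmentation of the resolution lifts to the extension E because the zeroth term is
   projective. *)
have [g0 g0E] := @res_proj _ _ _ R 0 _ _ q (res_aug R) epi_q.
have g0snd v x : (g0 v x).2 = res_aug R v x.
  by rewrite g0E comp_lfunE qE.
pose p1 v := sval (twisted_fst del0 delS D_rel v).
have p1E v x : p1 v x = x.1 := svalP (twisted_fst del0 delS D_rel v) x.
have aug_diff v x : res_aug R v (res_diff R 0 v x) = 0.
  by apply/eqP; rewrite -memv_ker res_exact0 memv_img // memvf.
have g0act j (l : 'I_(weight j)) x : p1 _ (g0 _ (act (res_term R 0) l x)) =
    act M l (p1 _ (g0 _ x)) + del j l (res_aug R _ x).
  by rewrite cmod_hom_nat [act _ _ _]twactE !p1E /= g0snd.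
have g0arr j l x : (l < weight j)%N ->
    p1 _ (g0 _ (arrow (act (res_term R 0)) j l x)) =
    arrow (act M) j l (p1 _ (g0 _ x)) + del j l (res_aug R _ x).
  move=> lt; rewrite (arrowE (act (res_term R 0)) (Ordinal lt)).
  by rewrite (arrowE (act M) (Ordinal lt)) (g0act j (Ordinal lt)).
(* The first component of the lift is not a homomorphism, but it becomes one on the boundaries,
   where the twist vanishes; this is the cocycle of the extension. *)
have [|f1 f1E] := @mk_hom_key _ _ (res_term R 1) M
    (fun v => p1 v \o g0 v \o res_diff R 0 v)%VF.
  move=> j l x; rewrite !comp_lfunE cmod_hom_nat g0act.
  by rewrite aug_diff linear0 addr0.
have [|g gE] := ext R f1.
  move=> v; apply/lfunP => x; rewrite f1E !comp_lfunE zero_lfunE.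
  suff -> : res_diff R 0 v (res_diff R 1 v x) = 0 by rewrite !linear0.
  by apply/eqP; rewrite -memv_ker res_exactS memv_img // memvf.
(* Subtracting g, whose boundary is that cocycle, leaves maps that vanish on the kernel of the
   augmentation and hence descend to M. *)
pose r v : 'Hom(res_term R 0 v, M v) := (p1 v \o g0 v)%VF - g v.
have rE v x : r v x = p1 v (g0 v x) - g v x.
  by rewrite /r add_lfunE opp_lfunE comp_lfunE.
have r_ker v x : res_aug R v x = 0 -> r v x = 0.
  move/eqP; rewrite -memv_ker res_exact0 => /memv_imgP[y _ ->].
  rewrite rE; apply/eqP; rewrite subr_eq0; apply/eqP.
  by have := gE v; rewrite f1E => /lfunP/(_ y); rewrite !comp_lfunE.
pose h v := (r v \o (res_aug R v)^-1)%VF.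
have hE v x : h v (res_aug R v x) = r v x by apply: factor_ker (@r_ker v) x.
exists h => j l x lt.
have /memv_imgP[y _ ->] : x \in limg (res_aug R (av j l.+1)).
  by rewrite res_aug_epi memvf.
rewrite -(hom_arrow (@cmod_hom_nat _ _ _ _ (res_aug R))) !hE !rE.
rewrite (hom_arrow (@cmod_hom_nat _ _ _ _ g)) linearB /= opprB.
by rewrite g0arr // addrA subrK addrAC subrr add0r.
Qed.

End Splitting.
End Resolutions.

(** * Injectivity of the maps of a brick *)

(** The upward counterpart of [descending_chain], with defaults below m. *)
Lemma ascending_chain (T : nat -> Type) (st : forall l, T l -> T l.+1) m (x : T m)
    (dflt : forall l, T l) :
  {s : forall l, T l | s m = x & forall l, (m <= l)%N -> s l.+1 = st l (s l)}.
Proof.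
elim: m T st x dflt => [|m IH] T st x dflt.
  by exists (fix s l := if l is l'.+1 then st l' (s l') else x).
have [s sm sS] := IH (T \o S) (fun l => st l.+1) x (fun l => dflt l.+1).
exists (fun l => if l is l'.+1 then s l' else dflt 0%N) => //.
by case=> // l; rewrite ltnS; apply: sS.
Qed.

Section Brick.
Variables (k : fieldType) (L : canonical_datum k) (M : cmodule L).
Implicit Types (i j : 'I_(arms L)) (l : nat).
Notation av := (@arm_vertex k L).
Notation arr := (arrow (act M)).
Notation up := (up (act M)).
Notation down := (down (act M)).
Notation phi := (arm_map (act M)).

Lemma limg_up_anti i l l' : (l <= l')%N -> (l' <= weight i)%N ->
  (limg (up i l') <= limg (up i l))%VS.
Proof.
move=> /subnK <-; elim: (l' - l)%N => [|d IH] lp; first exact: subvv.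
apply: subv_trans (IH (ltnW lp)); apply/subvP => _ /memv_imgP[x _ ->].
by rewrite upS // memv_img // memvf.
Qed.

(** Cramer's rule for three vectors in the span of the actions of the first two arms. *)
Lemma phi_det i i' j u :
  (arm_al i' * arm_be i - arm_al i * arm_be i') *: phi j u =
  (arm_al j * arm_be i - arm_al i * arm_be j) *: phi i' u +
  (arm_al i' * arm_be j - arm_al j * arm_be i') *: phi i u.
Proof.
rewrite (canonical_relE j) (canonical_relE i) (canonical_relE i').
rewrite !scalerDr !scalerA addrACA -!scalerDl; congr (_ *: _ + _ *: _); ring.
Qed.

Hypothesis brick : end_trivial M.
Hypothesis dV : (2 <= \dim {: M (Zero L)})%N.
Hypothesis dUV : (\dim {: M (Top L)} < \dim {: M (Zero L)})%N.

(** The endomorphism is v (x) psi at 0 and u (x) xi at c, with v = phi_i' u and xi = psi o phi_i'.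
    The choices of u and psi serve to extend it along the arm i. *)
Lemma brick_ker_sub i i' u : i != i' -> phi i u = 0 -> phi i' u = 0.
Proof.
move=> ii' u0; apply/eqP; apply: contraT => ui'.
(* For the last level l0 at which some such u dies, the kernel of the next map lies in ker phi_i';
   hence xi factors through the level l0 + 1. *)
pose b l := (l <= weight i)%N && ~~ (lker (down i l) <= lker (phi i'))%VS.
have b0 : exists l, b l.
  exists 0%N; apply/andP; split=> //; apply/subvPn; exists u.
    by rewrite memv_ker down0 u0.
  by rewrite memv_ker.
have bp l : b l -> (l <= weight i)%N by case/andP.
case: (ex_maxnP b0 bp) => l0 /andP[l0p /subvPn[]] {u u0 ui'} u.
rewrite !memv_ker => /eqP ul0 ui' l0max.
have {l0p} l0p : (l0 < weight i)%N.
  rewrite ltn_neqAle l0p andbT; apply: contraNneq ui' => e.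
  move: ul0; rewrite e down_weight => /(congr1 (top_uncast M i)).
  by rewrite top_castK !linear0 => ->; rewrite linear0.
have kerS x : down i l0.+1 x = 0 -> phi i' x = 0.
  move=> x0; apply/eqP; rewrite -memv_ker.
  suff /subvP : (lker (down i l0.+1) <= lker (phi i'))%VS.
    by apply; rewrite memv_ker x0.
  by apply: contraT => h; have := l0max l0.+1; rewrite /b h l0p ltnn => /(_ erefl).
have phi_img : (limg (up i (weight i)) != fullv)%VS.
  apply: contraTneq dUV => e; rewrite -leqNgt -e.
  have <- : limg (phi i) = limg (up i (weight i)).
    apply/vspaceP => y; apply/memv_imgP/memv_imgP => -[x _ ->].
      by exists (top_cast M i x); rewrite ?memvf // arm_mapE.
    exists (top_uncast M i x); rewrite ?memvf // arm_mapE.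
    by rewrite top_uncastK.
  by rewrite -[X in (_ <= X)%N](limg_ker_dim (phi i) fullv) leq_addl.
(* For the last level m mapping onto M_0, v lifts to m, and psi can be chosen to kill the images of
   all later levels. *)
pose b' l := (l <= weight i)%N && (limg (up i l) == fullv).
have b'0 : exists l, b' l.
  exists 0%N; rewrite /b' leq0n /= up0; apply/eqP/vspaceP => y.
  by rewrite memvf; apply/memv_imgP; exists y; rewrite ?memvf ?id_lfunE.
have b'p l : b' l -> (l <= weight i)%N by case/andP.
case: (ex_maxnP b'0 b'p) => m /andP[mp /eqP upm] mmax.
have {mp} mp : (m < weight i)%N.
  rewrite ltn_neqAle mp andbT; apply: contraNneq phi_img => <-.
  by rewrite upm.
have [y _ yN] : exists2 y, y \in fullv & y \notin limg (up i m.+1).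
  apply/subvPn; apply: contraT; rewrite negbK => h.
  have := mmax m.+1; rewrite /b' mp eqEsubv subvf h ltnn.
  by move=> /(_ erefl).
have [psi psi1 psi0] := separate yN.
have psi_up l x : (m < l)%N -> (l <= weight i)%N -> psi (up i l x) = 0.
  move=> ml lp; apply: psi0; apply: (subvP (limg_up_anti ml lp)).
  by rewrite memv_img // memvf.
have psi_phi x : psi (phi i x) = 0 by rewrite arm_mapE psi_up.
pose v := phi i' u.
have /memv_imgP[vm _ evm] : v \in limg (up i m) by rewrite upm memvf.
have [vl vlm vlS] := @descending_chain m (fun l => M (av i l))
  (fun l _ x => arr i l x) vm (fun _ => 0).
have vl0 : vl 0%N = v.
  have up_vl l : (l <= m)%N -> up i l (vl l) = v.
    move=> lm; rewrite -(subKn lm); elim: (m - l)%N => [|d IH].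
      by rewrite subn0 vlm.
    have [dm|dm] := ltnP d m; last first.
      by have -> : (m - d.+1 = m - d)%N by lia.
    have lt : (m - d.+1 < m)%N by lia.
    rewrite vlS // -upS //; last by lia.
    by have -> : ((m - d.+1).+1 = m - d)%N by lia.
  by have := up_vl 0%N (leq0n m); rewrite up0 id_lfunE.
pose xi : 'Hom(M (Top L), k^o) := (psi \o phi i')%VF.
have xiE x : xi x = psi (phi i' x) by rewrite /xi comp_lfunE.
have xi_ker x : down i l0.+1 x = 0 -> xi x = 0.
  by rewrite xiE => /kerS ->; rewrite linear0.
have [xl xlm xlS] := @ascending_chain (fun l => 'Hom(M (av i l), k^o))
  (fun l f => (f \o arr i l)%VF) l0.+1 (xi \o (down i l0.+1)^-1)%VF (fun _ => 0).
have xl_down l x : (l0 < l)%N -> (l <= weight i)%N -> xl l (down i l x) = xi x.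
  move=> /subnK <-; elim: (l - l0.+1)%N => [|d IH] lp.
    by rewrite xlm; apply: factor_ker.
  by rewrite xlS ?leq_addl // comp_lfunE -downS // IH // ltnW.
(* Cramer's rule with phi_i u = 0 and psi o phi_i = 0 gives phi_j u = c_j v and psi o phi_j = c_j
   psi o phi_i'. *)
pose c j := (arm_al j * arm_be i - arm_al i * arm_be j) /
            (arm_al i' * arm_be i - arm_al i * arm_be i').
have det0 : arm_al i' * arm_be i - arm_al i * arm_be i' != 0.
  by rewrite subr_eq0 arm_det // eq_sym.
have c0 j : j != i -> c j != 0.
  by move=> ji; rewrite mulf_neq0 ?invr_neq0 // subr_eq0 arm_det.
have phi_iu : phi i u = 0 by rewrite -(up_down _ _ (ltnW l0p)) ul0 linear0.
have phi_u j : phi j u = c j *: v.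
  apply: (scalerI det0); rewrite phi_det phi_iu scaler0 addr0 scalerA.
  by rewrite /c [_ * (_ / _)]mulrC divfK.
have psi_phij j x : psi (phi j x) = c j * psi (phi i' x).
  have := congr1 psi (phi_det i i' j x); rewrite functionalZ functionalP psi_phi.
  rewrite mulr0 addr0 => e; apply: (mulfI det0).
  by rewrite e mulrA /c [_ * (_ / _)]mulrC divfK.
(* On the arm i, v lifts to the levels l <= m, psi vanishes on the levels
   l > m, u dies in the levels l <= l0, and xi extends to the levels l > l0. *)
pose F j l : 'End(M (av j l)) :=
  if j == i then
    match @eqP _ i j with
    | ReflectT e => eq_rect i (fun j => 'End(M (av j l)))
        (outer (vl l) (psi \o up i l)%VF
         + (if (l0 < l)%N then outer (down i l u) (xl l) else 0)) j e
    | ReflectF _ => 0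
    end
  else (c j)^-1 *: outer (down j l u) (psi \o up j l)%VF.
have Fj j l x : j != i ->
    F j l x = (psi (up j l x) / c j) *: down j l u.
  move=> /negPf ji; rewrite /F ji scale_lfunE outerE comp_lfunE scalerA.
  by rewrite mulrC.
have Fi l x : F i l x = psi (up i l x) *: vl l
    + (if (l0 < l)%N then xl l x *: down i l u else 0).
  rewrite /F eqxx; case: eqP => // e; rewrite (eq_axiomK e) /=.
  rewrite add_lfunE outerE comp_lfunE; congr (_ + _).
  by case: ifP => _; rewrite ?outerE ?zero_lfunE.
have [|||f [f0 _ _]] := @build_hom _ _ M M F (outer v psi) (outer u xi).
- move=> j; apply/lfunP => x; rewrite outerE.
  have [->|ji] := eqVneq j i.
    by rewrite Fi /= addr0 up0 id_lfunE vl0.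
  by rewrite Fj // up0 id_lfunE down0 phi_u scalerA divfK // c0.
- move=> j x; rewrite outerE lfunZ xiE.
  have [->|ji] := eqVneq j i.
    rewrite Fi l0p -arm_mapE psi_phi scale0r add0r -(down_weight (act M)).
    by rewrite xl_down // xiE.
  by rewrite Fj // -arm_mapE psi_phij mulrC mulKf ?c0 // down_weight.
- move=> j l x lp; have [ej|ji] := eqVneq j i; last first.
    by rewrite !Fj // -!upS // lfunZ downS.
  subst j; rewrite !Fi -upS // lfunD lfunZ ltnS; congr (_ + _).
    have [lm|ml] := ltnP l m; first by rewrite vlS.
    by rewrite psi_up // !scale0r.
  have [l0l|ll0|el] := ltngtP l0 l; last first.
  - have dl0 : down i l u = 0 by rewrite -el.
    by rewrite lfunZ -downS // dl0 scaler0.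
  - by rewrite linear0.
  by rewrite lfunZ -downS // xlS // comp_lfunE.
have [d [fd _]] := brick f.
(* A nonzero scalar of rank one on M_0 contradicts dim M_0 >= 2. *)
have fE x : psi x *: v = d *: x.
  have <- : f (Zero L) x = psi x *: v by rewrite f0 outerE.
  by rewrite fd scale_lfunE id_lfunE.
have d0 : d != 0.
  apply: contraNneq ui' => d0; have := fE y.
  by rewrite psi1 scale1r d0 scale0r -/v => ->.
have : (fullv <= <[v]>)%VS.
  apply/subvP => x _; apply/vlineP; exists (d^-1 * psi x).
  by rewrite -scalerA fE scalerA mulVf ?scale1r.
move/dimvS; rewrite dim_vline => h.
by have := leq_trans dV h; case: (v != 0).
Qed.

(** An endomorphism that is 1 at 0 and factors through [up] at every level must be the identity
    since M is a brick, and this makes [up] injective. *)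
Lemma brick_injective i l x : (l <= weight i)%N -> up i l x = 0 -> x = 0.
Proof.
pose piU : 'End(M (Top L)) := ((phi (arm1 L))^-1 \o phi (arm1 L))%VF.
have phi_ker j j' u : phi j u = 0 -> phi j' u = 0.
  by have [->|] := eqVneq j j'; last exact: brick_ker_sub.
have phi_pi j u : phi j (piU u) = phi j u.
  apply/eqP; rewrite -subr_eq0 -linearB; apply/eqP/(phi_ker (arm1 L)).
  by rewrite linearB /piU comp_lfunE /= limg_lfunVK ?subrr // memv_img // memvf.
have pi_ker j u : phi j u = 0 -> piU u = 0.
  by move/(phi_ker _ (arm1 L)); rewrite /piU comp_lfunE => ->; rewrite linear0.
move: piU phi_pi pi_ker => piU phi_pi pi_ker.
(* The s j l below satisfy up j l \o s j l \o up j l = up j l, and the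
   s j l \o up j l form an idempotent endomorphism which is 1 at Zero. *)
pose section j l (s : 'Hom(M (Zero L), M (av j l))) :=
  forall x, up j l (s (up j l x)) = up j l x.
have sectionV j l' : section j l' (up j l')^-1%VF.
  by move=> z; rewrite limg_lfunVK // memv_img // memvf.
have step j l' (lt : (l' < weight j)%N) (s : {s | section j l'.+1 s}) :
    {t : {t | section j l' t} |
     forall z, sval t (up j l'.+1 z) = arr j l' (sval s (up j l'.+1 z))}.
  case: s => s sP; pose P := projv (limg (up j l'.+1)).
  have Pid z : P (up j l'.+1 z) = up j l'.+1 z.
    by rewrite projv_id // memv_img // memvf.
  (* On the image of the next level the section has to follow the arrow; on a complement the
     pseudo-inverse serves. *)
  have [t tE] : {t : 'Hom(M (Zero L), M (av j l')) | forall y,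
      t y = arr j l' (s (P y)) + ((up j l')^-1)%VF (y - P y)}.
    apply: lfun_ex => c y z.
    have -> : c *: y + z - P (c *: y + z) = c *: (y - P y) + (z - P z).
      by rewrite linearP scalerBr opprD addrACA.
    by rewrite !linearP /= addrACA -scalerDr.
  have tP : section j l' t.
    move=> z; rewrite tE lfunD -upS //.
    have /memv_imgP[w _ ew] : P (up j l' z) \in limg (up j l'.+1).
      exact: memv_proj.
    rewrite ew (sP w) upS //.
    have -> : up j l' z - up j l' (arr j l' w) = up j l' (z - arr j l' w).
      by rewrite lfunB.
    rewrite sectionV lfunB addrC; exact: subrK.
  exists (exist _ t tP) => z /=.
  by rewrite tE Pid subrr linear0 addr0.
(* The factor [piU] makes the endomorphism at c the same for all arms. *)
have top_section j : section j (weight j) (top_cast M j \o piU \o (phi j)^-1)%VF.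
  move=> z; rewrite !comp_lfunE -arm_mapE phi_pi limg_lfunVK //.
  by rewrite -(top_uncastK z) -arm_mapE memv_img ?memvf.
have sig_ex j : {s : forall l', 'Hom(M (Zero L), M (av j l')) |
    [/\ s (weight j) = (top_cast M j \o piU \o (phi j)^-1)%VF,
      section j 0%N (s 0%N) &
      forall l' z, (l' < weight j)%N ->
        s l' (up j l'.+1 z) = arr j l' (s l'.+1 (up j l'.+1 z))]}.
  have [s sp sS] := @descending_chain (weight j) (fun l' => {s | section j l' s})
    (fun l' lt s => sval (step j l' lt s)) (exist _ _ (top_section j))
    (fun l' => exist _ _ (sectionV j l')).
  exists (fun l' => sval (s l')); split; [by rewrite sp | exact: svalP |].
  by move=> l' z lt; rewrite (sS _ lt) (svalP (step _ _ lt _)).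
pose s j := sval (sig_ex j).
pose F j l' : 'End(M (av j l')) := (s j l' \o up j l')%VF.
have [|||f [f0 fp fF]] := @build_hom _ _ M M F \1%VF piU.
- move=> j; apply/lfunP => y; rewrite comp_lfunE id_lfunE.
  have [_ s0 _] := svalP (sig_ex j).
  by have := s0 y; rewrite up0 !id_lfunE.
- move=> j y; rewrite /F /s comp_lfunE -arm_mapE; have [-> _ _] := svalP (sig_ex j).
  rewrite !comp_lfunE; congr (top_cast _ _ _).
  apply/eqP; rewrite -subr_eq0 -linearB; apply/eqP/(pi_ker j).
  by rewrite lfunB limg_lfunVK ?subrr // memv_img // memvf.
- move=> j l' y lt; rewrite /F /s !comp_lfunE -upS //.
  by have [_ _ ->] := svalP (sig_ex j).
have [c [fc _]] := brick f.
have V0 : \dim {: M (Zero L)} != 0%N by rewrite -lt0n (leq_trans _ dV).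
have c1 : c = 1.
  rewrite dimv_eq0 -vpick0 in V0.
  have := fc (Zero L); rewrite f0 => /lfunP/(_ (vpick fullv)).
  rewrite scale_lfunE !id_lfunE => /eqP; rewrite -subr_eq0 -{1}(scale1r (vpick _)).
  by rewrite -scalerBl scaler_eq0 (negPf V0) orbF subr_eq0 => /eqP.
move=> lp x0; have := fc (av i l); rewrite fF // c1 scale1r => /lfunP/(_ x).
by rewrite comp_lfunE x0 linear0 id_lfunE.
Qed.

End Brick.

(** * Rigidity of the pencil and of the hyperplanes *)

Section Exceptional.
Variables (k : fieldType) (L : canonical_datum k) (M : cmodule L).
Implicit Types (i j : 'I_(arms L)) (l : nat).
Notation av := (@arm_vertex k L).
Notation arr := (arrow (act M)).
Notation up := (up (act M)).
Notation down := (down (act M)).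
Notation phi := (arm_map (act M)).
Notation U := (M (Top L)).
Notation V := (M (Zero L)).

Hypothesis brick : end_trivial M.
Hypothesis ext1 : ext_vanishS 0 M M.
Variable n : nat.
Hypothesis dU : \dim {: U} = n.
Hypothesis dV : \dim {: V} = n.+2.

Lemma up_inj0 i l x : (l <= weight i)%N -> up i l x = 0 -> x = 0.
Proof. by apply: brick_injective; rewrite ?dV ?dU. Qed.

Lemma up_ker i l : (l <= weight i)%N -> lker (up i l) == 0%VS.
Proof. by move=> lp; apply: lker0_trivial => x; apply: up_inj0. Qed.

Lemma up_inj i l : (l <= weight i)%N -> injective (up i l).
Proof. by move=> lp; apply/lker0P/up_ker. Qed.

Lemma down_inj0 i l x : (l <= weight i)%N -> down i l x = 0 -> x = 0.
Proof.
move=> lp x0; have := up_down (act M) x lp; rewrite x0 linear0 arm_mapE.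
move/esym/(up_inj0 (leqnn _))/(congr1 (top_uncast M i)).
by rewrite top_castK linear0.
Qed.

Lemma phi_inj0 i x : phi i x = 0 -> x = 0.
Proof. by rewrite -down0; apply: (down_inj0 (leq0n _)). Qed.

Lemma dim_up i l : (l <= weight i)%N ->
  \dim (limg (up i l)) = \dim {: M (av i l)}.
Proof. by move=> lp; apply: limg_dim_eq; rewrite capfv; apply/eqP/up_ker. Qed.

Lemma limg_phi_up i l : (l <= weight i)%N -> (limg (phi i) <= limg (up i l))%VS.
Proof.
move=> lp; apply/subvP => _ /memv_imgP[x _ ->].
by rewrite -(up_down _ _ lp) memv_img // memvf.
Qed.

Lemma dim_phi i : \dim (limg (phi i)) = n.
Proof.
rewrite -dU; apply: limg_dim_eq; rewrite capfv; apply/eqP.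
by apply: lker0_trivial => x; apply: phi_inj0.
Qed.

Lemma dim_level i l : (l <= weight i)%N -> (n <= \dim {: M (av i l)} <= n.+2)%N.
Proof.
move=> lp; rewrite -dim_up // -{1}(dim_phi i) dimvS ?limg_phi_up //=.
by rewrite -dV dimvS // subvf.
Qed.

Lemma dim_level_anti i l l' : (l <= l')%N -> (l' <= weight i)%N ->
  (\dim {: M (av i l')} <= \dim {: M (av i l)})%N.
Proof.
move=> ll' lp; rewrite -!dim_up ?(leq_trans ll') //.
by apply/dimvS/limg_up_anti.
Qed.

Lemma limg_up_eq i l l' : (l <= weight i)%N -> (l' <= weight i)%N ->
  \dim {: M (av i l)} = \dim {: M (av i l')} -> limg (up i l) = limg (up i l').
Proof.
have gen l1 l2 : (l1 <= l2)%N -> (l2 <= weight i)%N ->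
    \dim {: M (av i l1)} = \dim {: M (av i l2)} -> limg (up i l1) = limg (up i l2).
  move=> h lp e; apply/esym/eqP; rewrite eqEdim limg_up_anti //=.
  by rewrite !dim_up ?(leq_trans h) // e.
move=> lp lp' e; case/orP: (leq_total l l') => h; first exact: gen.
by symmetry; apply: gen.
Qed.

Lemma pencil_atE i x : pencil_at (@arm_al _ L) (@arm_be _ L)
  (phi (arm1 L)) (phi (arm2 L)) i x = phi i x.
Proof. by rewrite [RHS]canonical_relE. Qed.

(** Deforming each arm by al_j D1 + be_j D2 respects the canonical relations; the components at 0
    and c of a splitting trivialize the deformation, up to sign. *)
Lemma exceptional_rigid_pencil : rigid_pencil (phi (arm1 L)) (phi (arm2 L)).
Proof.
move=> D1 D2; pose D j := arm_al j *: D1 + arm_be j *: D2.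
pose del j l : 'Hom(M (av j l.+1), M (av j l)) := match l with
  (* The deformation is put on the first arrow of the arm, which is possible because M_c embeds into
     the level 1. *)
  | 0 => (D j \o (down j 1)^-1)%VF | _ => 0 end.
have del0 j y : del j 0%N (down j 1 y) = D j y.
  by apply: factor_ker => x /(down_inj0 (weight_gt0 j)) ->; rewrite linear0.
have delS j l y : (l.+1 < weight j)%N -> del j l.+1 (down j l.+2 y) = 0.
  by rewrite zero_lfunE.
have D_rel j : (2 <= j)%N -> D j = D (arm1 L) + param j *: D (arm2 L).
  move=> j2; rewrite /D; have [-> ->] := arm_coef1 L; have [-> ->] := arm_coef2 L.
  by have [-> ->] := arm_coef_ge2 j2; rewrite !scale1r !scale0r addr0 add0r.
have [h hE] := ext_vanish_split del0 delS D_rel ext1.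
have key j y : D j y = h (Zero L) (phi j y) - phi j (h (Top L) y).
  (* From level 1 on, h commutes with the arrows. At level 0 it need not, so the family is continued
     there by the arrow. *)
  pose s l : M (av j l) := match l with
    | 0 => arr j 0 (h (av j 1) (down j 1 y))
    | l'.+1 => h (av j l'.+1) (down j l'.+1 y) end.
  have s0 : s 0%N = down j 0 (h (Top L) y).
    apply: (@down_unique _ _ _ (act M) j s) => //.
      have -> : s (weight j) = h (av j (weight j)) (down j (weight j) y).
        by rewrite /s; move: (weight_gt0 j); case: (weight j).
      by rewrite down_weight (hom_cast h).
    case=> [|l] lp //; rewrite -[s l.+1]/(h (av j l.+1) (down j l.+1 y)).
    rewrite -[s l.+2]/(h (av j l.+2) (down j l.+2 y)) downS //.
    have := hE j l.+1 (down j l.+2 y) lp; rewrite zero_lfunE => /esym/eqP.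
    by rewrite subr_eq0 => /eqP.
  rewrite -[phi j (h _ y)]down0 -s0 -del0 hE ?weight_gt0 //.
  by rewrite -downS ?weight_gt0 // down0.
exists (- h (Top L)), (- h (Zero L)); split=> x.
  have := key (arm1 L) x; rewrite /D; have [-> ->] := arm_coef1 L.
  rewrite scale1r scale0r addr0 => ->.
  by rewrite !opp_lfunE opprK linearN /= addrC.
have := key (arm2 L) x; rewrite /D; have [-> ->] := arm_coef2 L.
rewrite scale1r scale0r add0r => ->.
by rewrite !opp_lfunE opprK linearN /= addrC.
Qed.

(** An equation of the hyperplane in the filtration of the arm i; l is the level from which the
    images drop from V to that hyperplane. *)
Definition level_functional i (psi : 'Hom(V, k^o)) := psi != 0 /\
  exists l, [/\ (l < weight i)%N, limg (up i l) = fullv &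
                limg (up i l.+1) = lker psi].

(** The arms on which the filtration falls from codimension 0 to 2 through a hyperplane. *)
Definition special : {set 'I_(arms L)} :=
  [set i | [exists l : 'I_(weight i).+1, \dim {: M (av i l)} == n.+1]].

Lemma special_functional i : i \in special -> exists psi, level_functional i psi.
Proof.
rewrite inE => /existsP[l1 /eqP d1].
pose b l := (l <= weight i)%N && (\dim {: M (av i l)} == n.+1).
have b_ex : exists l, b l.
  by exists l1; rewrite /b d1 eqxx andbT -ltnS.
case: (ex_minnP b_ex) => -[|l] /andP[lp /eqP dl] lmin.
  by move: dl; rewrite dV => /eqP; rewrite eqn_leq ltnn.
have dl0 : \dim {: M (av i l)} = n.+2.
  have /andP[_ le] := dim_level (ltnW lp).
  have := dim_level_anti (leqnSn l) lp; rewrite dl leq_eqVlt => /predU1P[e|lt].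
    by have := lmin l; rewrite /b (ltnW lp) -e eqxx ltnn => /(_ isT).
  by apply/eqP; rewrite eqn_leq le.
have [y _ yN] : exists2 y, y \in fullv & y \notin limg (up i l.+1).
  apply/subvPn; apply: contraTN isT => /dimvS.
  by rewrite dim_up // dl dV ltnn.
have [psi psi1 psi0] := separate yN; exists psi; split.
  apply: contraTneq (oner_neq0 k) => p0; rewrite negbK -psi1 p0.
  by rewrite zero_lfunE.
exists l; split=> //.
  by apply/eqP; rewrite eqEdim subvf /= dim_up ?(ltnW lp) // dl0 dV.
apply/eqP; rewrite eqEdim dim_up // dl; apply/andP; split.
  by apply/subvP => x /psi0 x0; rewrite memv_ker x0.
rewrite -ltnS -dV ltn_neqAle dimvS ?subvf // andbT.
apply: contraNneq (oner_neq0 k) => e; have : lker psi == fullv.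
  by rewrite eqEdim subvf /= e.
by move/eqP => ef; have := memvf y; rewrite -ef memv_ker psi1.
Qed.

Lemma level_functional_phi i psi x : level_functional i psi -> psi (phi i x) = 0.
Proof.
case=> _ [l [lp _ e]]; apply/eqP; rewrite -memv_ker -e.
by rewrite -(up_down _ _ lp) memv_img // memvf.
Qed.

Lemma level_functional_ker i psi l : i \in special -> level_functional i psi ->
  (l <= weight i)%N -> \dim {: M (av i l)} = n.+1 -> limg (up i l) = lker psi.
Proof.
move=> iS [psi0 [l0 [l0p full e]]] lp dl; rewrite -e; apply: limg_up_eq => //.
have le := limg_ker_dim psi fullv.
have img1 : (\dim (limg psi) <= 1)%N.
  by rewrite (leq_trans (dimvS (subvf _))) // dimvf.
have img0 : (0 < \dim (limg psi))%N.
  rewrite lt0n dimv_eq0; apply: contra psi0 => /eqP e0.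
  apply/eqP/lfunP => x; rewrite zero_lfunE; apply/eqP.
  by rewrite -memv0 -e0 memv_img // memvf.
rewrite -(dim_up l0p) e dl; move: le; rewrite capfv dV; lia.
Qed.

(** Only the arrow into level l0 is deformed, by a rank one map that kills the image of M_c, so no
    arm action changes. The splitting is then an endomorphism of the pencil that commutes with all
    arrows but this one, and it moves only ker psi_i. *)
Lemma exceptional_separated (psi : 'I_(arms L) -> 'Hom(V, k^o)) :
  (forall i, i \in special -> level_functional i (psi i)) ->
  separated (phi (arm1 L)) (phi (arm2 L)) special psi.
Proof.
move=> psiP i iS; have [psi0 [l0 [l0p full ker_psi]]] := psiP i iS.
have dl : \dim {: M (av i l0.+1)} = n.+1.
  move: iS; rewrite inE => /existsP[l1 /eqP d1].
  have l1p : (l1 <= weight i)%N by rewrite -ltnS.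
  rewrite -dim_up // ker_psi -(level_functional_ker _ (psiP i _) l1p d1) ?dim_up //;
    by rewrite inE; apply/existsP; exists l1; rewrite d1.
have [z _ zN] : exists2 z, z \in fullv & z \notin limg (down i l0.+1).
  apply/subvPn/negP => /dimvS; rewrite dl.
  by have := limg_ker_dim (down i l0.+1) fullv; rewrite dU; lia.
have [chi chi1 chi0] := separate zN.
have [y psi_y] : exists y, psi i y = 1.
  case/lfunPn: psi0 => y; rewrite zero_lfunE => y0.
  exists ((psi i y)^-1 *: y); rewrite functionalZ; exact: mulVf.
have /memv_imgP[y' _ ey'] : y \in limg (up i l0) by rewrite full memvf.
pose del j l : 'Hom(M (av j l.+1), M (av j l)) :=
  match @eqP _ (i, l0) (j, l) with
  | ReflectT e => eq_rect (i, l0) (fun p => 'Hom(M (av p.1 p.2.+1), M (av p.1 p.2)))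
                    (outer y' chi) (j, l) e
  | ReflectF _ => 0
  end.
have del_other j l : (j, l) != (i, l0) -> del j l = 0.
  by rewrite eq_sym /del; case: eqP.
have del_here : del i l0 = outer y' chi.
  by rewrite /del; case: eqP => // e; rewrite (eq_axiomK e).
have del_down j l x : del j l (down j l.+1 x) = 0.
  have [[-> ->]|ne] := eqVneq (j, l) (i, l0); last first.
    by rewrite del_other // zero_lfunE.
  by rewrite del_here outerE chi0 ?scale0r // memv_img // memvf.
have [h hE] : exists h : forall v, 'End(M v), forall j l x, (l < weight j)%N ->
    del j l x = h (av j l) (arr j l x) - arr j l (h (av j l.+1) x).
  apply: (@ext_vanish_split _ _ M del (fun _ => 0)) => //.
  - by move=> j x; rewrite del_down zero_lfunE.
  - by move=> j _; rewrite scaler0 addr0.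
have h_arr j l x : (l < weight j)%N -> (j, l) != (i, l0) ->
    h (av j l) (arr j l x) = arr j l (h (av j l.+1) x).
  move=> lp ne; have := hE j l x lp; rewrite del_other // zero_lfunE => /esym/eqP.
  by rewrite subr_eq0 => /eqP.
have h_phi j x : h (Zero L) (phi j x) = phi j (h (Top L) x).
  rewrite -!down0; apply: (@down_unique _ _ _ (act M) j
    (fun l => h (av j l) (down j l x)) (h (Top L) x) _ _ 0%N) => //.
    by rewrite down_weight (hom_cast h).
  move=> l lp; rewrite downS //.
  have := hE j l (down j l.+1 x) lp; rewrite del_down => /esym/eqP.
  by rewrite subr_eq0 => /eqP.
have h_up j l x : (l <= weight j)%N -> (forall l', (l' < l)%N -> (j, l') != (i, l0)) ->
    h (Zero L) (up j l x) = up j l (h (av j l) x).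
  elim: l x => [|l IH] x lp ne; first by rewrite up0 !id_lfunE.
  rewrite upS // IH 1?ltnW //; last by move=> l' l'l; apply: ne; rewrite ltnW.
  by rewrite h_arr ?ne // upS.
exists (h (Top L)), (h (Zero L)); split.
- by split=> x; rewrite h_phi.
- move=> j jS ji; have [psij0 [l [lp _ ker_j]]] := psiP j jS.
  have [|c cE] := @proportional _ _ (psi j) (psi j \o h (Zero L))%VF psij0.
    move=> x /eqP; rewrite -memv_ker -ker_j => /memv_imgP[w _ ->].
    rewrite comp_lfunE h_up // => [|l' _]; last by rewrite xpair_eqE (negPf ji).
    by apply/eqP; rewrite -memv_ker -ker_j memv_img // memvf.
  by exists c => x; rewrite -cE comp_lfunE.
(* Applying psi_i o up to the deformation equation at z gives 1 on the left; if psi_i were an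
   eigenvector, both terms on the right would vanish. *)
case=> c cE; have := hE i l0 z l0p; rewrite del_here outerE chi1 scale1r.
move/(congr1 (up i l0)); rewrite lfunB -ey' -h_up ?(ltnW l0p) //; last first.
  by move=> l' l'l; rewrite xpair_eqE eqxx /= neq_ltn l'l.
rewrite -!upS // => /(congr1 (psi i)); rewrite psi_y lfunB cE.
have ker0 w : psi i (up i l0.+1 w) = 0.
  by apply/eqP; rewrite -memv_ker -ker_psi memv_img // memvf.
rewrite !ker0 mulr0 subrr => /eqP; exact/negP/oner_neq0.
Qed.

End Exceptional.

(** * Matrices *)

Section Combinations.
Variables (k : fieldType) (ok : k -> Prop).
Hypotheses (ok0 : ok 0) (ok1 : ok 1).

Definition combination (V : vectType k) (X : seq V) (b : V) :=
  exists a : nat -> k, (forall s, ok (a s)) /\ b = \sum_(s < size X) a s *: X`_s.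

Lemma combination_mem (V : vectType k) (X : seq V) b : b \in X -> combination X b.
Proof.
move=> bX; exists (fun s => if s == index b X then 1 else 0).
split=> [s|]; first by case: ifP.
have lt : (index b X < size X)%N by rewrite index_mem.
rewrite (bigD1 (Ordinal lt)) //= eqxx scale1r nth_index // big1 ?addr0 // => s.
by rewrite -val_eqE /= => /negPf->; rewrite scale0r.
Qed.

Lemma combination2 (V : vectType k) (X : seq V) p q c d : (p < q < size X)%N ->
  ok c -> ok d -> combination X (c *: X`_p + d *: X`_q).
Proof.
move=> /andP[pq qX] okc okd.
exists (fun s => if s == p then c else if s == q then d else 0).
split=> [s|]; first by do !case: ifP.
rewrite (bigD1 (Ordinal (ltn_trans pq qX))) //= eqxx; congr (_ + _).
rewrite (bigD1 (Ordinal qX)) /=; last by rewrite -val_eqE /= gtn_eqF.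
rewrite eqxx gtn_eqF // big1 ?addr0 // => s.
by rewrite -!val_eqE /= => /andP[/negPf-> /negPf->]; rewrite scale0r.
Qed.

Lemma map_lfun1 (V : vectType k) (f : 'End(V)) (s : seq V) :
  f = \1%VF -> map f s = s.
Proof. by move->; rewrite -[RHS]map_id; apply: eq_map => x; rewrite id_lfunE. Qed.

Lemma mxof_entry (U V : vectType k) (e : (\dim {:U}).-tuple U)
    (e' : (\dim {:V}).-tuple V) (f : 'Hom(U, V)) r s :
  passmx.mxof e e' f r s = coord e' s (f e`_r).
Proof. by rewrite mxE /= passmx.vecof_delta mxE. Qed.

End Combinations.

(** * Compatible bases along the arms *)

Section Bases.
Variables (k : fieldType) (L : canonical_datum k) (M : cmodule L).
Implicit Types (i j : 'I_(arms L)) (l : nat).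
Notation av := (@arm_vertex k L).
Notation arr := (arrow (act M)).
Notation up := (up (act M)).
Notation down := (down (act M)).
Notation phi := (arm_map (act M)).
Notation U := (M (Top L)).
Notation V := (M (Zero L)).

Hypothesis brick : end_trivial M.
Hypothesis ext1 : ext_vanishS 0 M M.
Variable n : nat.
Hypothesis dU : \dim {: U} = n.
Hypothesis dV : \dim {: V} = n.+2.

Variables (us : nat -> U) (vs : nat -> V) (w : 'I_(arms L) -> V).
Hypothesis us_span : (<<mkseq us n>> = fullv)%VS.
Hypothesis vs_span : (<<mkseq vs n.+2>> = fullv)%VS.
Hypothesis w_level : forall i l, (l <= weight i)%N -> \dim {: M (av i l)} = n.+1 ->
  w i \in limg (up i l) /\ w i \notin limg (phi i).

(** A basis of the image in V of a level of dimension d. It depends only on i and d, so arrows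
    between levels of equal dimension get identity matrices. *)
Definition level_seq i d : seq V :=
  if d == n.+2 then mkseq vs n.+2 else
  if d == n then [seq phi i u | u <- mkseq us n]
  else w i :: [seq phi i u | u <- mkseq us n].

Lemma level_seqP i l (d := \dim {: M (av i l)}) : (l <= weight i)%N ->
  (<<level_seq i d>> = limg (up i l))%VS /\ size (level_seq i d) = d.
Proof.
move=> lp; have := dim_up brick dU dV lp; rewrite -/d => dl.
have := dim_level brick dU dV lp; rewrite -/d => /andP[nd dn].
have phi_span : (<<[seq phi i u | u <- mkseq us n]>> = limg (phi i))%VS.
  by rewrite -limg_span us_span.
have phi_up := limg_phi_up M lp; have dphi := dim_phi brick dU dV i.
rewrite /level_seq; case: eqP => [e|/eqP ne].
  rewrite vs_span size_mkseq; split=> //; symmetry; apply/eqP.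
  by rewrite eqEdim subvf dl e dV /=.
case: eqP => [e|/eqP ne'].
  rewrite phi_span size_map size_mkseq; split=> //; apply/eqP.
  by rewrite eqEdim phi_up dl dphi e /=.
have d1 : d = n.+1 by lia.
have [wl wN] := w_level lp d1.
rewrite /= size_map size_mkseq; split; last by rewrite d1.
apply/eqP; rewrite eqEdim span_cons phi_span subv_add phi_up -memvE wl /=.
rewrite dl d1 dimv_disjoint_sum.
  rewrite dphi dim_vline; case: eqP wN => [->|_ _]; first by rewrite mem0v.
  by rewrite add1n.
apply/eqP; rewrite -subv0; apply/subvP => x; rewrite memv_cap memv0.
case/andP=> /vlineP[c ->] cw; apply: contraNT wN; rewrite scaler_eq0 negb_or.
by case/andP=> c0 _; rewrite -(scalerK c0 (w i)) memvZ.
Qed.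

Definition level_basis i l : seq (M (av i l)) :=
  [seq ((up i l)^-1)%VF b | b <- level_seq i (\dim {: M (av i l)})].

Lemma up_level_basis i l : (l <= weight i)%N ->
  map (up i l) (level_basis i l) = level_seq i (\dim {: M (av i l)}).
Proof.
move=> lp; rewrite -map_comp -[RHS]map_id; apply/eq_in_map => b bB /=.
by rewrite limg_lfunVK // -(level_seqP lp).1 memv_span.
Qed.

Lemma level_basisP i l : (l <= weight i)%N ->
  basis_of {: M (av i l)} (level_basis i l) /\
  size (level_basis i l) = \dim {: M (av i l)}.
Proof.
move=> lp; have [sp sz] := level_seqP lp.
have sz' : size (level_basis i l) = \dim {: M (av i l)} by rewrite size_map.
split=> //; rewrite basisEdim sz' leqnn andbT.
rewrite -(limg_ker0 _ _ (up_ker brick dU dV lp)) limg_span up_level_basis //.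
by rewrite sp.
Qed.

Lemma bases_glue : {e : forall v, seq (M v) | forall i l, (l <= weight i)%N ->
  e (av i l) = level_basis i l}.
Proof.
have e0 i : level_basis i 0 = mkseq vs n.+2.
  have h := up_level_basis (leq0n (weight i)).
  rewrite /level_seq dV eqxx in h; rewrite -h; symmetry.
  exact: (map_lfun1 _ (up0 (act M) i)).
have cast_seq v v' (e : v = v') (s : seq (M v)) :
    eq_rect v (fun v => seq (M v)) s v' e = map (cast_lfun M e) s.
  by case: _ / e; rewrite map_lfun1.
have dtop i : \dim {: M (av i (weight i))} = n by rewrite arm_vertex_weight.
have ep i : eq_rect _ (fun v => seq (M v)) (level_basis i (weight i)) _
    (arm_vertex_weight i) = mkseq us n.
  rewrite cast_seq -/(top_uncast M i) /level_basis dtop /level_seq eqxx.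
  rewrite ltn_eqF // -!map_comp; apply: eq_map => x /=.
  rewrite arm_mapE lker0_lfunK ?top_castK //.
  exact: (up_ker brick dU dV (leqnn _)).
have [e [_ _ eE]] := glue (T := fun v => seq (M v)) e0 ep.
by exists e.
Qed.

Variable ok : k -> Prop.
Hypotheses (ok0 : ok 0) (ok1 : ok 1).
Hypothesis ok_phi : forall i (q : nat), (q < n)%N ->
  combination ok (mkseq vs n.+2) (phi i (us q)).
Hypothesis ok_w : forall i l, (l <= weight i)%N -> \dim {: M (av i l)} = n.+1 ->
  combination ok (mkseq vs n.+2) (w i).

Lemma level_seq_combination i l b : (l < weight i)%N ->
  b \in level_seq i (\dim {: M (av i l.+1)}) ->
  combination ok (level_seq i (\dim {: M (av i l)})) b.
Proof.
move=> lp; have := dim_level_anti brick dU dV (leqnSn l) lp.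
have := dim_level brick dU dV lp; have := dim_level brick dU dV (ltnW lp).
have := ok_w lp; move: (\dim {: M (av i l)}) (\dim {: M (av i l.+1)}) => d d'.
move=> okw /andP[d1 d2] /andP[d'1 d'2] d'd bB.
have [e|ne] := eqVneq d d'; first by apply: combination_mem; rewrite ?e.
have d'n : d' != n.+2 by lia.
move: bB; rewrite {1}/level_seq (negPf d'n).
have phiP u' : u' \in [seq phi i u | u <- mkseq us n] ->
    combination ok (mkseq vs n.+2) u'.
  case/mapP=> u0 u0s ->; case/mapP: u0s => j jn ->.
  by apply: ok_phi; rewrite mem_iota in jn.
have [e'|ne'] := eqVneq d' n.
  rewrite /level_seq; have [_|dn] := eqVneq d n.+2; first exact: phiP.
  rewrite e' in ne; rewrite (negPf ne).
  by move=> bB; apply: combination_mem; rewrite // inE bB orbT.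
have e : d' = n.+1 by lia.
have -> : d = n.+2 by lia.
rewrite /level_seq eqxx inE => /predU1P[->|]; [exact: okw | exact: phiP].
Qed.

(** Since [up] is injective and compatible with the arrows, the matrix of an arrow expresses one
    level basis in another inside V. *)
Lemma matrices_exist :
  exists e : forall v : vertex L, (\dim {: M v}).-tuple (M v),
    (forall v, basis_of {: M v} (e v)) /\
    (forall i (m : 'I_(weight i)) r s,
       ok (passmx.mxof (e (av i m.+1)) (e (av i m)) (act M m) r s)).
Proof.
have [es esE] := bases_glue.
have sz v : size (es v) == \dim {: M v}.
  have [i [l [lp ->]]] := vertexP v; rewrite esE //.
  by rewrite (level_basisP lp).2.
exists (fun v => Tuple (sz v)); split=> [v|i m r s].
  by have [i [l [lp ev]]] := vertexP v; rewrite /= ev esE // (level_basisP lp).1.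
rewrite mxof_entry; set X := Tuple (sz (av i m)).
have mp := ltn_ord m; have bX : basis_of fullv X.
  by rewrite /X /= esE ?(ltnW mp) // (level_basisP (ltnW mp)).1.
set x := (X' in act M m X').
have xB : up i m.+1 x \in level_seq i (\dim {: M (av i m.+1)}).
  rewrite -up_level_basis // -esE // map_f // mem_nth //.
  by rewrite (eqP (sz _)).
have [a [oka ax]] := level_seq_combination mp xB.
suff -> : act M m x = \sum_(s < \dim {: M (av i m)}) a s *: X`_s.
  by rewrite coord_sum_free // (basis_free bX).
apply: (up_inj brick dU dV (ltnW mp)); rewrite -arrowE -upS // ax linear_sum /=.
have [_ szl] := level_seqP (ltnW mp).
rewrite szl; apply: eq_bigr => t _; rewrite lfunZ -up_level_basis ?(ltnW mp) //.
rewrite (nth_map 0) -?esE ?(ltnW mp) // (eqP (sz _)); exact: ltn_ord.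
Qed.

End Bases.

(** The coefficients that occur are those of phi_i u_q = al_i v_q + be_i v_(q+2) and the coordinates
    0, 1 of w_i. *)
Lemma rigid_brick_matrices (k : fieldType) (L : canonical_datum k)
    (M : cmodule L) (ok : k -> Prop) :
  end_trivial M -> ext_vanishS 0 M M -> rank M = 2 ->
  ok 0 -> ok 1 -> (forall j : 'I_(arms L), (2 <= j)%N -> ok (param j)) ->
  exists e : forall v : vertex L, (\dim {: M v}).-tuple (M v),
    (forall v, basis_of {: M v} (e v)) /\
    (forall (i : 'I_(arms L)) (m : 'I_(weight i)) r s,
       ok (passmx.mxof (e (arm_vertex i m.+1)) (e (arm_vertex i m)) (act M m) r s)).
Proof.
move=> brick ext1 rkM ok0 ok1 okp.
pose n := \dim {: M (Top L)}.
have dV : \dim {: M (Zero L)} = n.+2 by move: rkM; rewrite /rank /n; lia.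
have dU : \dim {: M (Top L)} = n by [].
pose phi := arm_map (act M); pose S := special M n.
have ok_al (i : 'I_(arms L)) : ok (arm_al i) by rewrite /arm_al; case: ifP.
have ok_be (i : 'I_(arms L)) : ok (arm_be i).
  case: (arm_cases i) => [->|->|h]; first by rewrite (arm_coef1 L).2.
    by rewrite (arm_coef2 L).2.
  by rewrite (arm_coef_ge2 h).2; apply: okp.
have [psi psiP] : exists psi : 'I_(arms L) -> 'Hom(M (Zero L), k^o),
    forall i, i \in S -> level_functional i (psi i).
  apply: fin_all_exists (fun i psi => i \in S -> level_functional i psi) _ => i.
  case: (boolP (i \in S)) => [iS|_]; last by exists 0.
  by have [psi] := special_functional brick dU dV iS; exists psi.
have psi_phi i x : i \in S ->
    psi i (pencil_at (@arm_al _ L) (@arm_be _ L) (phi (arm1 L)) (phi (arm2 L)) i x) = 0.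
  by move=> iS; rewrite pencil_atE; apply: level_functional_phi (psiP i iS).
have [us [vs [us1 us2 us_span vs_span spec]]] :=
  pencil_normal_form (@arm_be0 _ L) (@arm_det _ L) (fun i iS => (psiP i iS).1)
    (exceptional_separated brick ext1 dU dV psiP) psi_phi
    (exceptional_rigid_pencil brick ext1 dU dV) dU dV.
have vs_nth q : (q < n.+2)%N -> vs q = (mkseq vs n.+2)`_q by move=> ?; rewrite nth_mkseq.
have ok_phi (i : 'I_(arms L)) (q : nat) : (q < n)%N ->
    combination ok (mkseq vs n.+2) (phi i (us q)).
  move=> qn; rewrite -pencil_atE /pencil_at us1 // us2 // !vs_nth ?ltnS //; last by lia.
  by apply: combination2 => //; rewrite size_mkseq !ltnS qn leqnSn.
have [w wP] : exists w : 'I_(arms L) -> M (Zero L), forall i, i \in S ->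
    [/\ psi i (w i) = 0, w i \notin limg (phi i) & combination ok (mkseq vs n.+2) (w i)].
  apply: (@fin_all_exists _ _ (fun i w => i \in S -> [/\ psi i w = 0,
    w \notin limg (phi i) & combination ok (mkseq vs n.+2) w])) => i.
  case: (boolP (i \in S)) => [iS|_]; last by exists 0.
  have [c [d /= [w0 wN]]] := spec i iS; eexists => _; split; first exact: w0.
    by apply/negP => /memv_imgP[x _ e]; case/eqP: (wN x); rewrite pencil_atE.
  have okb (b : bool) : ok b%:R by case: b.
  case: ifP => _; rewrite !vs_nth ?leqnSn //; apply: combination2 => //;
    by rewrite size_mkseq ltnSn /= ?ltnSn.
have special_dim (i : 'I_(arms L)) l : (l <= weight i)%N ->
    \dim {: M (arm_vertex i l)} = n.+1 -> i \in S.
  rewrite -ltnS => lp dl; rewrite inE; apply/existsP.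
  by exists (Ordinal lp); rewrite dl.
apply: (matrices_exist brick dU dV us_span vs_span (w := w)) => // i l lp dl;
  have iS := special_dim i l lp dl; have [w1 w2 w3] := wP i iS => //.
split=> //; rewrite (level_functional_ker brick dU dV iS (psiP i iS) lp dl).
by rewrite memv_ker w1.
Qed.

Theorem theorem4 (k : closedFieldType) (L : canonical_datum k)
    (M : cmodule L) (excM : exceptional M) (rkM : rank M = 2) :
  exists e : forall v : vertex L, (\dim {: M v}).-tuple (M v),
    (forall v, basis_of {: M v} (e v)) /\
    (forall (i : 'I_(arms L)) (m : 'I_(weight i)) r s,
       let x := passmx.mxof (e (arm_vertex i m.+1)) (e (arm_vertex i m)) (act M m) r s in
       x = 0 \/
       exists2 j : 'I_(arms L), (2 <= j)%N & x = param j \/ x = - param j).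
Proof.
have [brick ext] := excM.
apply: (rigid_brick_matrices (ok := fun x : k => x = 0 \/
  exists2 j : 'I_(arms L), (2 <= j)%N & x = param j \/ x = - param j)) => //.
- by left.
(* The entry 1 is allowed because it equals lambda_3. *)
- right; exists (Ordinal (arms_ge3 L)) => //.
  by left; rewrite param_norm.
by move=> j j2; right; exists j => //; left.
Qed.
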